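(* The linear estimate in the $A_1$ conjecture (also called the weak Muckenhoupt--Wheeden conjecture) is impossible: there is no absolute constant $C$ such that $\|H\|_{L^1(w)\to L^{1,\infty}(w)}\le C\,[w]_{A_1}$ for all $A_1$ weights $w$. Moreover, both the weak norm of the martingale transform and the weak norm of the Hilbert transform from $L^1(w)$ into $L^{1,\infty}(w)$ grow at least like $c\,[w]_{A_1}\log^{\frac15-\epsilon}[w]_{A_1}$. That is, for every $\epsilon\in(0,\tfrac15)$ there is a constant $c=c(\epsilon)>0$ such that: (a) (martingale transform) there exist weights $w$ with arbitrarily large finite $[w]_{A_1}$ for which $$\|T\|_{L^1(w)\to L^{1,\infty}(w)}\ \ge\ c\,[w]_{A_1}\,\log^{\frac15-\epsilon}[w]_{A_1};$$ (b) (Hilbert transform) there exist weights $w$ with arbitrarily large finite $[w]_{A_1}$ for which $$\|H\|_{L^1(w)\to L^{1,\infty}(w)}\ \ge\ c\,[w]_{A_1}\,\log^{\frac15-\epsilon}[w]_{A_1}.$$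
   Context: A weight $w$ is a locally integrable, almost everywhere positive function, and $w(E)=\int_E w\,dx$. For the Hilbert transform, $w$ is a weight on $\mathbb{R}$ and $[w]_{A_1}:=\sup_x\frac{Mw(x)}{w(x)}$ (supremum up to null sets), where $M$ is the Hardy--Littlewood maximal function. $H$ is the Hilbert transform on $\mathbb{R}$. The norm $\|H\|_{L^1(w)\to L^{1,\infty}(w)}\in[0,\infty]$ is the least $K$ with $\lambda\,w(\{x:|H\varphi(x)|>\lambda\})\le K\int|\varphi|\,w\,dx$ for all $\lambda>0$ and all $\varphi\in L^1(w)$ for which $H\varphi$ is defined. For the martingale transform, $w$ is a weight on $I_0=[0,1]$ and $[w]_{A_1}$ is the dyadic $A_1$ norm, i.e. the least $Q$ such that $\frac1{|I|}\int_I w\,dx\le Q\inf_I w$ for all dyadic intervals $I\subseteq I_0$ ($\inf$ being essential). The martingale transform is the family of operators $T\varphi=\sum_{I\subseteq I_0,\ I\text{ dyadic}}\epsilon_I(\varphi,h_I)h_I$ with $-1\le\epsilon_I\le1$, where $(\cdot,\cdot)$ is the $L^2$ inner product and $h_I$ is the $L^2$-normalized Haar function of $I$ ($|I|^{-1/2}$ on one half of $I$, $-|I|^{-1/2}$ on the other half, $0$ off $I$). Its weak norm $\|T\|_{L^1(w)\to L^{1,\infty}(w)}$ is the least $K$ such that $\lambda\,w(\{x\in I_0:|T\varphi(x)|>\lambda\})\le K\int_{I_0}|\varphi|\,w\,dx$ for all $\lambda>0$, all $\varphi\in L^1(I_0,w\,dx)$ for which $T\varphi$ is defined, and all choices of the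 $\epsilon_I$. The $A_1$ conjecture is the assertion that the Hilbert transform maps $L^1(w)$ to $L^{1,\infty}(w)$ with norm bounded by an absolute constant times $[w]_{A_1}$. *)

(* Defs.v *)
From HB Require Import structures.
From mathcomp Require Import all_boot all_order all_algebra.
From mathcomp Require Import all_classical all_reals all_analysis.
From mathcomp Require Import ess_sup_inf.
Set Implicit Arguments.
Unset Strict Implicit.
Unset Printing Implicit Defensive.
Import Order.TTheory GRing.Theory Num.Theory.
Import numFieldNormedType.Exports.

Local Open Scope classical_set_scope.
Local Open Scope ring_scope.

Section weighted_weak_type.
Context {R : realType}.
Local Notation mu := (@lebesgue_measure R).
Implicit Types (D : set R) (w f : R -> R) (n k : nat).

(* w(D) *)
Definition weighted_measure w D : \bar R := (\int[mu]_(x in D) (w x)%:E)%E.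

Definition weighted_L1 D w f : Prop :=
  measurable_fun D f /\ (\int[mu]_(x in D) (`|f x| * w x)%:E < +oo)%E.

Definition weak_type_bound D w (K : \bar R) f (Tf : R -> R) : Prop :=
  forall l : R, 0 < l ->
    (l%:E * weighted_measure w (D `&` [set x | l < `|Tf x|]%R)
     <= K * \int[mu]_(x in D) (`|f x| * w x)%:E)%E.

Definition line_weight w : Prop :=
  locally_integrable setT w /\ \forall x \ae mu, 0 < w x.

Definition A1_norm w : \bar R :=
  ess_sup mu (fun x => HL_maximal w x * ((w x)^-1)%:E)%E.

Definition hilbert_trunc f (x e : R) : R :=
  pi^-1 * \int[mu]_(y in [set y | e < `|x - y|]) (f y / (x - y)).

Definition hilbert f (x : R) : R := lim (hilbert_trunc f x e @[e --> 0^'+]).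

(* The principal value exists almost everywhere, each truncated integral being
   absolutely convergent. *)
Definition hilbert_defined f : Prop :=
  \forall x \ae mu,
    (forall e : R, 0 < e ->
       mu.-integrable [set y | e < `|x - y|] (fun y => (f y / (x - y))%:E)) /\
    cvg (hilbert_trunc f x e @[e --> 0^'+]).

Definition hilbert_weak_norm w : \bar R :=
  ereal_inf [set K : \bar R | (0 <= K)%E /\
    forall f, weighted_L1 setT w f -> hilbert_defined f ->
      weak_type_bound setT w K f (hilbert f)].

Definition unit_itv : set R := `[0, 1]%classic.

Definition unit_weight w : Prop :=
  mu.-integrable unit_itv (EFin \o w) /\
  \forall x \ae mu, unit_itv x -> 0 < w x.

(* For k < 2 ^ n, the k-th dyadic subinterval of length 2 ^- n of [0, 1]; taking
   it half-open only affects null sets. *)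
Definition dyadic n k : set R := [set` dyadic_itv R n k].

Lemma measurable_dyadic n k : measurable (dyadic n k).
Proof. exact: measurable_itv. Qed.

Definition dyadic_ess_inf w n k : \bar R :=
  ess_inf (mrestr mu (measurable_dyadic n k)) (EFin \o w).

Definition dyadic_A1_norm w : \bar R :=
  ereal_inf [set Q%:E | Q in [set Q : R |
    forall n k, (k < 2 ^ n)%N ->
      (iavg w (dyadic n k) <= Q%:E * dyadic_ess_inf w n k)%E]].

(* sqrt (2 ^ n) is the L2-normalization |I|^(-1/2), and the two halves of I are
   its children in the dyadic tree. *)
Definition haar n k (x : R) : R :=
  Num.sqrt (2 ^+ n) *
  (\1_(dyadic n.+1 k.*2) x - \1_(dyadic n.+1 k.*2.+1) x).

Definition haar_coef f n k : R := \int[mu]_(x in unit_itv) (f x * haar n k x).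

(* At each point at most one interval per generation contributes, so the series
   is summed generation by generation. *)
Definition martingale_partial (eps : nat -> nat -> R) f (x : R) (N : nat) : R :=
  \sum_(0 <= n < N) \sum_(0 <= k < 2 ^ n) eps n k * haar_coef f n k * haar n k x.

Definition martingale (eps : nat -> nat -> R) f (x : R) : R :=
  lim (martingale_partial eps f x N @[N --> \oo]).

Definition martingale_defined (eps : nat -> nat -> R) f : Prop :=
  mu.-integrable unit_itv (EFin \o f) /\
  \forall x \ae mu, unit_itv x -> cvg (martingale_partial eps f x N @[N --> \oo]).

Definition martingale_weak_norm w : \bar R :=
  ereal_inf [set K : \bar R | (0 <= K)%E /\
    forall (eps : nat -> nat -> R) f,
      (forall n k, -1 <= eps n k <= 1) ->
      weighted_L1 unit_itv w f -> martingale_defined eps f ->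
      weak_type_bound unit_itv w K f (martingale eps f)].

End weighted_weak_type.

(* Main.v *)
Require Import Defs.
From HB Require Import structures.
From mathcomp Require Import all_boot all_order all_algebra.
From mathcomp Require Import all_classical all_reals all_analysis.
From mathcomp Require Import measurable_realfun ess_sup_inf.
From mathcomp Require Import ring lra zify.
Set Implicit Arguments.
Unset Strict Implicit.
Unset Printing Implicit Defensive.
Import Order.TTheory GRing.Theory Num.Theory.
Import numFieldNormedType.Exports.

Local Open Scope classical_set_scope.
Local Open Scope ring_scope.

(** The example is self-similar.  Cut [0, 1) into H = 4 ^ L tiles and keep those
    in the shells [1/2 + 4^-j/2, 1/2 + 4^-j), 2 <= j < L.  Off the kept tiles
    the weight is 1/Q; each kept tile receives a rescaled copy of the previous
    generation, multiplied by the inverse density of the kept tiles, so that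
    the kept tiles of each generation carry w-mass about 1.  This is repeated H
    times, with Q = H.  In each generation f has a mass -1 spread over [0, 1/4) and a mass
    +1 concentrated just to the right of 1/2.

    The base region of a tile is small-weight on both sides of the kept tiles,
    hence [w]_{A_1} is comparable to Q.  A generation of f costs 2/Q in L^1(w),
    so f costs 2 in all.  On shell j, which has relative measure about 4^-j, a
    generation contributes about 4^j to the transform: all L scales contribute
    equally, and the mean contribution is about L.  The contributions of
    distinct generations are independent for w, and the exponential Chebyshev
    inequality gives a transform at least c H L on half of the w-mass.  As L is
    comparable to log [w]_{A_1}, both weak norms are at least
    c [w]_{A_1} log [w]_{A_1}, which is more than what is claimed.

    Tiles do not hurt each other: for the martingale transform because f has
    mean zero in each tile, for the Hilbert transform because the positive mass
    of f lies to the right of the negative one, which makes the transform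
    nonnegative outside of the tile. *)

(** * Step functions as lists of pieces *)

Section step_data.
Context {R : realType}.
Implicit Types (s F : seq (R * R * R)) (p q x a b g : R).

(* A list of triples (c, a, b) stands for the sum of the c 1_[a, b), or of the
   c 1_]a, b[ when the boolean flag is false. *)
Definition inpiece (c : bool) a b x := x \in Interval (BSide c a) (BLeft b).

Definition stepf (c : bool) s x : R :=
  \sum_(t <- s) t.1.1 * (inpiece c t.1.2 t.2 x)%:R.

Definition overlap a b p q : R := Num.max 0 (Num.min b q - Num.max a p).

(** The integral of [stepf c s] from [p] to [q] as a finite sum; [integral_stepf_itv] justifies this
    reading. *)
Definition mass s p q : R := \sum_(t <- s) t.1.1 * overlap t.1.2 t.2 p q.

(* The principal value of the integral of f(y) / (x - y), for f = stepf true s. *)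
Definition pv s x : R :=
  \sum_(t <- s) t.1.1 * ln (`|x - t.1.2| / `|x - t.2|).

Definition within01 s := {in s, forall t, [/\ 0 <= t.1.2, t.1.2 <= t.2 & t.2 <= 1]}.

Lemma inpieceE c a b x : inpiece c a b x = (if c then a <= x else a < x) && (x < b).
Proof. by case: c; rewrite /inpiece in_itv. Qed.

Lemma overlap_ge0 a b p q : 0 <= overlap a b p q.
Proof. by rewrite /overlap le_max lexx. Qed.

Lemma overlapC a b p q : overlap a b p q = overlap p q a b.
Proof. by rewrite /overlap (minC b) (maxC a). Qed.

Lemma overlap_full a b p q : a <= b -> p <= a -> b <= q -> overlap a b p q = b - a.
Proof.
move=> ab pa bq; rewrite /overlap (min_idPl bq) (max_idPl pa).
by apply/max_idPr; rewrite subr_ge0.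
Qed.

Lemma overlap_eq0 a b p q : (b <= p) || (q <= a) -> overlap a b p q = 0.
Proof.
move=> h; apply/max_idPl; rewrite subr_le0 ge_min !le_max.
by case/orP: h => ->; rewrite ?orbT.
Qed.

Lemma overlap_le a b p q : p <= q -> overlap a b p q <= q - p.
Proof.
move=> pq; rewrite /overlap ge_max subr_ge0 pq /=.
by apply: lerB; rewrite ?ge_min ?le_max lexx orbT.
Qed.

Lemma overlap_lel a b p q : a <= b -> overlap a b p q <= b - a.
Proof. by rewrite overlapC; apply: overlap_le. Qed.

Lemma overlap_split a b c p q : a <= b -> b <= c ->
  overlap a b p q + overlap b c p q = overlap a c p q.
Proof.
move=> ab bc; rewrite /overlap.
by case: (leP b q) => ?; case: (leP c q) => ?; case: (leP a p) => ?;
  case: (leP b p) => ?; do ? case: (leP 0) => ?; lra.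
Qed.

Definition pos_coef s := {in s, forall t, 0 <= t.1.1}.

Lemma stepf_ge0 c s x : pos_coef s -> 0 <= stepf c s x.
Proof.
move=> s0; rewrite /stepf big_seq; apply: sumr_ge0 => t ts.
by rewrite mulr_ge0 ?s0.
Qed.

Lemma mass_le_total s p q : within01 s -> pos_coef s ->
  mass s p q <= mass s 0 1.
Proof.
move=> s01 s0; rewrite /mass !big_seq; apply: ler_sum => t ts.
apply: ler_wpM2l; first exact: s0.
have [h1 h2 h3] := s01 _ ts.
by rewrite (@overlap_full _ _ 0 1) // overlap_lel.
Qed.

Lemma mass_total s p q : within01 s -> p <= 0 -> 1 <= q -> mass s p q = mass s 0 1.
Proof.
move=> s01 p0 q1; rewrite /mass !big_seq; apply: eq_bigr => t ts.
have [h1 h2 h3] := s01 _ ts.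
by rewrite !overlap_full // ?(le_trans p0) // (le_trans h3).
Qed.

Lemma mass_out s p q : within01 s -> (q <= 0) || (1 <= p) -> mass s p q = 0.
Proof.
move=> s01 pq; rewrite /mass big_seq big1 // => t ts.
have [h1 h2 h3] := s01 _ ts.
rewrite overlap_eq0 ?mulr0 //; case/orP: pq => pq.
- by rewrite (le_trans pq h1) orbT.
- by rewrite (le_trans h3 pq).
Qed.

Lemma stepf_out c s x : within01 s -> (x < 0) || (1 <= x) -> stepf c s x = 0.
Proof.
move=> s01 x01; rewrite /stepf big_seq big1 // => t ts.
have [h1 h2 h3] := s01 _ ts.
rewrite inpieceE; case/orP: x01 => hx.
- have xa := lt_le_trans hx h1.
  by case: c; rewrite ?(leNgt _ x) ?xa ?(lt_gtF xa) /= mulr0.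
- by rewrite (ltNge x) (le_trans h3 hx) andbF mulr0.
Qed.


(** Both bounds come from ln u <= u - 1, applied to u = (x - a) / (x - b) and to its inverse. The
    hypothesis says that [x] lies strictly on one side of both [a] and [b]. *)
Lemma ln_ratio_bounds a b x : 0 < (x - a) * (x - b) ->
  (b - a) / (x - a) <= ln (`|x - a| / `|x - b|) <= (b - a) / (x - b).
Proof.
move=> ab.
have /andP[xa xb] : (x - a != 0) && (x - b != 0).
  by rewrite -negb_or -mulf_eq0 gt_eqF.
have ln_le u : 0 < u -> ln u <= u - 1 :> R.
  by move=> u0; have := expR_ge1Dx (ln u); rewrite lnK ?posrE //; lra.
have u0 : 0 < (x - a) / (x - b).
  have -> : (x - a) / (x - b) = (x - a) * (x - b) / (x - b) ^+ 2 by field.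
  by rewrite divr_gt0 // exprn_even_gt0.
have -> : `|x - a| / `|x - b| = (x - a) / (x - b).
  by rewrite -normf_div gtr0_norm.
apply/andP; split.
- have := ln_le ((x - a) / (x - b))^-1; rewrite invr_gt0 lnV ?posrE // => /(_ u0).
  have -> : ((x - a) / (x - b))^-1 - 1 = - ((b - a) / (x - a)).
    by field; rewrite xa xb.
  by rewrite lerN2.
- apply: le_trans (ln_le _ u0) _.
  by rewrite le_eqVlt; apply/orP; left; apply/eqP; field.
Qed.

End step_data.

(** * Lebesgue integrals of step functions *)

Section step_integral.
Context {R : realType}.
Local Notation mu := (@lebesgue_measure R).
Implicit Types (s : seq (R * R * R)) (p q x a b : R) (c : bool).

Definition piece c a b : set R := [set` Interval (BSide c a) (BLeft b)].

Lemma measurable_piece c a b : measurable (piece c a b).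
Proof. exact: measurable_itv. Qed.

Lemma stepfE c s x : stepf c s x = \sum_(t <- s) t.1.1 * \1_(piece c t.1.2 t.2) x.
Proof.
apply: eq_bigr => t _; congr (_ * _); rewrite indicE; congr (_%:R).
by rewrite mem_setE.
Qed.

Lemma measurable_stepf c s D : measurable_fun D (stepf c s).
Proof.
rewrite (_ : stepf c s = fun x => \sum_(t <- s) t.1.1 * \1_(piece c t.1.2 t.2) x).
  apply: measurable_sum => t; apply: measurable_funM => //.
  by apply: measurable_indic; exact: measurable_piece.
by apply/funext => x; rewrite stepfE.
Qed.

Lemma integrable_piece c a b D : measurable D ->
  mu.-integrable D (fun x => (\1_(piece c a b) x)%:E).
Proof.
move=> mD; apply: (integrableS _ mD (@subsetT _ _)) => //.
exact: integrable_indic_itv.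
Qed.

Lemma integrable_stepf c s D : measurable D ->
  mu.-integrable D (fun x => (stepf c s x)%:E).
Proof.
move=> mD; under eq_fun do rewrite stepfE -sumEFin.
apply: integrable_sum => // t _.
under eq_fun do rewrite EFinM.
by apply: integrableZl => //; exact: integrable_piece.
Qed.

Lemma integral_stepf c s D : measurable D ->
  (\int[mu]_(x in D) (stepf c s x)%:E =
   \sum_(t <- s) t.1.1%:E * mu (piece c t.1.2 t.2 `&` D))%E.
Proof.
move=> mD; under eq_integral do rewrite stepfE -sumEFin.
rewrite integral_sum // => [|t].
  apply: eq_bigr => t _; under eq_integral do rewrite EFinM.
  rewrite integralZl //; last exact: integrable_piece.
  by rewrite integral_indic //; exact: measurable_piece.
under eq_fun do rewrite EFinM.
by apply: integrableZl => //; exact: integrable_piece.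
Qed.

(** Whatever the boundary types, the intersection lies between the open and the closed interval from
    [Num.max a p] to [Num.min b q], and these have the same measure. *)
Lemma mu_piece_itv c a b (b0 b1 : bool) p q :
  mu (piece c a b `&` [set` Interval (BSide b0 p) (BSide b1 q)]) =
  (overlap a b p q)%:E.
Proof.
set m := Num.max a p; set n := Num.min b q.
have E d0 d1 : mu [set` Interval (BSide d0 m) (BSide d1 n)] = (overlap a b p q)%:E.
  rewrite lebesgue_measure_itv /= /overlap -/m -/n.
  rewrite lte_fin; case: ltP => mn.
    by rewrite -EFinB; congr EFin; apply/esym/max_idPr; rewrite subr_ge0 ltW.
  by congr EFin; apply/esym/max_idPl; rewrite subr_le0.
have mAD : measurable (piece c a b `&` [set` Interval (BSide b0 p) (BSide b1 q)]).
  by apply: measurableI; exact: measurable_itv.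
apply/eqP; rewrite eq_le -{1}(E true false) -{1}(E false true); apply/andP; split.
- apply: le_measure; rewrite ?inE //.
  move=> x [/=]; rewrite !itv_boundlr !lteBSide /= /m /n => /andP[h1 h2] /andP[h3 h4].
  rewrite ge_max le_min.
  by rewrite (lteifW h1) (lteifW h2) (lteifW h3) (lteifW h4).
- apply: le_measure; rewrite ?inE //.
  move=> x /=; rewrite !itv_boundlr !bnd_simp /= gt_max lt_min.
  move=> /andP[/andP[h1 h2] /andP[h3 h4]].
  rewrite /piece /= itv_boundlr; split; apply/andP; split;
  rewrite ?lteBSide /=; do ?[exact: lteifS | by []].
Qed.

Lemma integral_stepf_itv c s (b0 b1 : bool) p q :
  (\int[mu]_(x in [set` Interval (BSide b0 p) (BSide b1 q)]) (stepf c s x)%:E =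
   (mass s p q)%:E)%E.
Proof.
rewrite integral_stepf; last exact: measurable_itv.
rewrite /mass -sumEFin; apply: eq_bigr => t _.
by rewrite mu_piece_itv EFinM.
Qed.

Lemma integral_stepfT c s : within01 s ->
  (\int[mu]_x (stepf c s x)%:E = (mass s 0 1)%:E)%E.
Proof.
move=> s01; rewrite integral_stepf // /mass -sumEFin big_seq [RHS]big_seq.
apply: eq_bigr => t ts; rewrite EFinM; congr (_ * _)%E.
have [h1 h2 h3] := s01 _ ts.
rewrite -(@mu_piece_itv c _ _ true true) setIT; congr (mu _).
apply/esym/setIidPl => x /=.
rewrite !itv_boundlr !bnd_simp => /andP[k1 k2]; rewrite (lt_le_trans k2 h3) andbT.
by apply: (le_trans h1); case: c k1; rewrite bnd_simp // => /ltW.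
Qed.

(* The level sets of the transforms are not known to be measurable; monotonicity
   holds regardless, the integral of a nonnegative function being a supremum over
   the simple functions below it. *)
Lemma integral_le_nonmeasurable (D D' : set R) (f g : R -> \bar R) :
  (forall x, D x -> 0 <= f x)%E -> (forall x, D' x -> 0 <= g x)%E ->
  (forall x, f \_ D x <= g \_ D' x)%E ->
  (\int[mu]_(x in D) f x <= \int[mu]_(x in D') g x)%E.
Proof.
move=> f0 g0 fg; rewrite !ge0_integralE //; apply: le_ereal_sup => _ [h hf <-].
by exists h => // x; rewrite (le_trans (hf x)).
Qed.

End step_integral.

(** * Hilbert transform of step functions *)

Section hilbert_step.
Context {R : realType}.
Local Notation mu := (@lebesgue_measure R).
Implicit Types (s : seq (R * R * R)) (p q x y a b e : R) (c : bool).

Lemma continuous_kernel x y : x != y -> {for y, continuous (fun z => (x - z)^-1)}.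
Proof.
move=> xy; apply: cvgV; first by rewrite subr_eq0.
by apply: cvgB; [exact: cvg_cst | exact: cvg_id].
Qed.

Lemma measurable_kernel x (D : set R) : measurable D -> ~ D x ->
  measurable_fun D (fun y => (x - y)^-1).
Proof.
move=> mD Dx; apply: (@measurable_funS _ _ _ _ (~` [set x])).
- by apply: measurableC; exact: measurable_set1.
- by move=> y Dy yx; apply: Dx; rewrite -yx.
apply: open_continuous_measurable_fun.
  by rewrite openC; exact: closed_eq.
move=> y; rewrite inE /= => yx; apply: continuous_kernel.
by apply/eqP => xy; apply: yx.
Qed.

Lemma integral_kernel_cc x a b : a < b -> 0 < (x - a) * (x - b) ->
  (\int[mu]_(y in `[a, b]) ((x - y)^-1)%:E)%E = (ln (`|x - a| / `|x - b|))%:E.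
Proof.
move=> ab xab.
(* [k] is the common sign of [x - y] on [a, b], so that - ln (k (x - y)) is an antiderivative of the
   kernel on either side of [x]. *)
have [k [k2 kpos]] : exists k : R, k * k = 1 /\ forall y, a <= y <= b -> 0 < k * (x - y).
  have [xa|xa] := ltP 0 (x - a).
    exists 1; split; first by rewrite mulr1.
    by move=> y /andP[ay yb]; move: xab; rewrite pmulr_rgt0 // mul1r; lra.
  exists (-1); split; first by rewrite mulrNN mulr1.
  move=> y /andP[ay yb]; rewrite mulN1r oppr_gt0.
  suff : x - a < 0 by lra.
  rewrite lt_neqAle xa andbT; apply: contraTneq xab => ->.
  by rewrite mul0r ltxx.
have xy y : a <= y <= b -> x != y.
  move=> /kpos; apply: contraTneq => ->; by rewrite subrr mulr0 ltxx.
pose F y := - ln (k * (x - y)).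
have dF y : a <= y <= b -> is_derive y 1 F ((x - y)^-1).
  move=> yab.
  have d1 : is_derive y 1 (fun z => k * (x - z)) (- k).
    by apply: is_derive_eq; rewrite /GRing.scale /= add0r mul1r mulrN mulr1.
  pose g z := k * (x - z).
  have d2 := @is_derive1_comp _ (@ln R) g y _ _ (is_derive1_ln (kpos _ yab)) d1.
  suff <- : - ((k * (x - y))^-1 * - k) = (x - y)^-1 by exact: is_deriveN.
  have k0 : k != 0.
    by apply: contra_eq_neq k2 => ->; rewrite mul0r eq_sym oner_eq0.
  by field; rewrite k0 subr_eq0 xy.
have cF y : a <= y <= b -> F z @[z --> y] --> F y.
  move=> /dF [dy _]; apply: differentiable_continuous.
  exact/derivable1_diffP.
have ab' : a <= a <= b /\ a <= b <= b by rewrite !lexx (ltW ab).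
rewrite (@continuous_FTC2 _ _ F) //.
- rewrite -EFinB /F; congr EFin; rewrite opprK addrC -ln_div ?posrE ?kpos ?ab'.1 ?ab'.2 //.
  congr ln; have kn : `|k| = 1 
    by apply: (pexpIrn (n := 2)) => //; rewrite ?nnegrE // -normrX expr2 k2 normr1 expr1n.
  rewrite -(gtr0_norm (kpos a ab'.1)) -(gtr0_norm (kpos b ab'.2)) !normrM kn !mul1r.
  by [].
- apply: continuous_in_subspaceT => y; rewrite inE /= in_itv /= => yab.
  by apply: continuous_kernel; exact: xy.
- split.
  + move=> y; rewrite in_itv /= => /andP[h1 h2].
    by case: (dF y _) => //; rewrite !ltW.
  + by apply: cvg_at_right_filter; exact: cF ab'.1.
  + by apply: cvg_at_left_filter; exact: cF ab'.2.
- move=> y; rewrite in_itv /= => /andP[h1 h2].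
  have yab : a <= y <= b by rewrite !ltW.
  by have [_ <-] := dF y yab; rewrite derive1E.
Qed.


Lemma integral_kernel (d : bool) x a b : a < b -> 0 < (x - a) * (x - b) ->
  (\int[mu]_(y in [set` Interval (BSide d a) (BLeft b)]) ((x - y)^-1)%:E)%E =
  (ln (`|x - a| / `|x - b|))%:E.
Proof.
move=> ab xab; rewrite -integral_kernel_cc //.
have nx (i : interval R) : [set` i] `<=` `[a, b] ->
    measurable_fun [set` i] (fun y => ((x - y)^-1)%:E).
  move=> iab; apply/measurable_EFinP; apply: measurable_kernel.
    exact: measurable_itv.
  move=> /iab /=; rewrite in_itv /= => /andP[ax xb]; move: xab.
  by apply/negP; rewrite -leNgt mulr_ge0_le0 // ?subr_ge0 ?subr_le0.
rewrite integral_itv_bndo_bndc; last first.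
  apply: nx => y /=; rewrite in_itv /=.
  by case: d; rewrite in_itv /= => /andP[h1 h2]; apply/andP; split; lra.
case: d => //; rewrite integral_itv_obnd_cbnd //; apply: nx.
exact: subset_itv_oc_cc.
Qed.

Lemma measurable_far x e : measurable [set y | e < `|x - y|].
Proof.
rewrite (_ : [set y | _] = setT `&` (fun y => `|x - y|) @^-1` `]e, +oo[%classic).
  have : measurable_fun setT (fun y => `|x - y|).
    apply: measurableT_comp => //.
    by apply: measurable_funB => //; exact: measurable_id.
  by apply => //; exact: measurable_itv.
by rewrite setTI; apply/seteqP; split => y /=; rewrite in_itv /= andbT.
Qed.

Lemma integrable_trunc_piece a b x e : 0 < e ->
  mu.-integrable [set y | e < `|x - y|]
    (fun y => (\1_(piece true a b) y / (x - y))%:E).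
Proof.
move=> e0; have mD := measurable_far x e.
have nD : ~ [set y | e < `|x - y|] x.
  by rewrite /= subrr normr0; apply/negP; rewrite -leNgt ltW.
have H := @integrableZl _ _ _ mu _ mD (e^-1) _ (integrable_piece true a b mD).
refine (@le_integrable _ _ _ mu _ mD _ _ _ _ H).
- apply/measurable_EFinP; apply: measurable_funM; last exact: measurable_kernel.
  by apply: measurable_indic; exact: measurable_piece.
- move=> y /= ey; rewrite lee_fin !normrM mulrC ler_wpM2r //.
  rewrite normfV [leRHS]gtr0_norm ?invr_gt0 // lef_pV2 ?posrE ?ltW //.
  exact: lt_trans ey.
Qed.

(** For [x] inside the piece, the symmetric truncation leaves ln ((x - a) / e) and ln (e / (b - x)),
    and [e] cancels in the sum. Hence the truncated integral is constant as soon as [e] is below the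
    distance from [x] to the endpoints, and no limit has to be computed. *)
Lemma trunc_piece a b x : a < b -> x != a -> x != b ->
  exists2 d, 0 < d & forall e, 0 < e < d ->
    \int[mu]_(y in [set y | e < `|x - y|]) (\1_(piece true a b) y / (x - y)) =
    ln (`|x - a| / `|x - b|).
Proof.
move=> ab xa xb.
have E e : \int[mu]_(y in [set y | e < `|x - y|]) (\1_(piece true a b) y / (x - y)) =
    \int[mu]_(y in piece true a b `&` [set y | e < `|x - y|]) (x - y)^-1.
  rewrite Rintegral_mkcond [RHS]Rintegral_mkcond; congr Rintegral.
  apply/funext => y; rewrite /patch in_setI indicE.
  by case: (y \in piece _ _ _); case: ifP => //=; rewrite ?mul1r ?mul0r.
have subA e : piece true a b `<=` [set y | e < `|x - y|] ->
    0 < (x - a) * (x - b) ->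
    \int[mu]_(y in [set y | e < `|x - y|]) (\1_(piece true a b) y / (x - y)) =
    ln (`|x - a| / `|x - b|).
  by move=> /setIidPl AD xab; rewrite E AD /Rintegral integral_kernel.
have [xlea|ax] := ltP x a.
  exists (a - x); first by rewrite subr_gt0.
  move=> e /andP[e0 ed]; apply: subA; last by rewrite -mulrNN mulr_gt0 // ; lra.
  move=> y; rewrite /piece /= in_itv /= => /andP[ay yb].
  by rewrite ltr0_norm; lra.
have [bx|xleb] := ltP b x.
  exists (x - b); first by rewrite subr_gt0.
  move=> e /andP[e0 ed]; apply: subA; last by rewrite mulr_gt0 //; lra.
  move=> y; rewrite /piece /= in_itv /= => /andP[ay yb].
  by rewrite gtr0_norm; lra.
have {}ax : a < x by rewrite lt_neqAle eq_sym xa.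
have {}bx : x < b by rewrite lt_neqAle xb.
exists (Num.min (x - a) (b - x)); first by rewrite lt_min !subr_gt0 ax.
move=> e; rewrite lt_min => /and3P[e0 ea eb]; rewrite E.
have -> : piece true a b `&` [set y | e < `|x - y|] =
    piece true a (x - e) `|` piece false (x + e) b.
  apply/seteqP; split => y; rewrite /piece /= !in_itv /=.
    by move=> [/andP[ay yb]]; rewrite lter_normr; case/orP => ?; [left|right]; lra.
  by move=> [|] /andP[h1 h2]; split; rewrite ?lter_normr; lra.
have k1 : 0 < (x - a) * (x - (x - e)) by rewrite mulr_gt0 //; lra.
have k2 : 0 < (x - (x + e)) * (x - b) by rewrite -mulrNN mulr_gt0 //; lra.
rewrite /Rintegral integral_setU_EFin /=.
- rewrite !integral_kernel //=; [|lra|lra].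
  have -> : `|x - (x - e)| = e by rewrite opprB addrCA subrr addr0 gtr0_norm.
  have -> : `|x - (x + e)| = e by rewrite opprD addNKr normrN gtr0_norm.
  rewrite -lnM ?posrE ?divr_gt0 ?normr_gt0 ?subr_eq0 //.
  by congr ln; field; rewrite normr_eq0 subr_eq0 xb gt_eqF.
- exact: measurable_piece.
- exact: measurable_piece.
- apply: measurable_kernel.
    by apply: measurableU; exact: measurable_piece.
  by rewrite /piece /= !in_itv /= => -[|] /andP[]; lra.
- apply/disj_setPS => y; rewrite /piece /= !in_itv /= => -[/andP[h1 h2] /andP[h3 h4]]; lra.
Qed.

Definition endpoints s := [seq t.1.2 | t <- s] ++ [seq t.2 | t <- s].

Definition nonempty_pieces s := {in s, forall t, t.1.2 < t.2}.

Lemma integrable_trunc_stepf s x e : 0 < e ->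
  mu.-integrable [set y | e < `|x - y|] (fun y => (stepf true s y / (x - y))%:E).
Proof.
move=> e0; have mD := measurable_far x e.
rewrite (_ : (fun y => _) = fun y => (\sum_(t <- s) t.1.1%:E *
    (\1_(piece true t.1.2 t.2) y / (x - y))%:E)%E); last first.
  apply/funext => y; rewrite stepfE mulr_suml -sumEFin.
  by apply: eq_bigr => t _; rewrite -mulrA EFinM.
apply: integrable_sum => [|t _]; first exact: mD.
by apply: integrableZl => //; exact: integrable_trunc_piece.
Qed.

Definition trunc_integral (f : R -> R) x e :=
  \int[mu]_(y in [set y | e < `|x - y|]) (f y / (x - y)).

Lemma trunc_integral_stepf s x : nonempty_pieces s -> x \notin endpoints s ->
  exists2 d, 0 < d & forall e, 0 < e < d ->
    trunc_integral (stepf true s) x e = pv s x.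
Proof.
elim: s => [|t s IH] ps xs.
  exists 1 => // e _; rewrite /trunc_integral /pv big_nil.
  rewrite (_ : (fun y => stepf true [::] y / (x - y)) = fun=> 0).
    by rewrite /Rintegral integral0.
  by apply/funext => y; rewrite /stepf big_nil mul0r.
move: xs; rewrite /endpoints /= in_cons mem_cat in_cons !negb_or.
move=> /and4P[xt1 xs1 xt2 xs2].
have pt : t.1.2 < t.2 by apply: ps; rewrite mem_head.
have [d1 d10 h1] := trunc_piece pt xt1 xt2.
have [| |d2 d20 h2] := IH.
- by move=> u us; apply: ps; rewrite inE us orbT.
- by rewrite mem_cat negb_or xs1.
exists (Num.min d1 d2); first by rewrite lt_min d10.
move=> e; rewrite lt_min => /and3P[e0 ed1 ed2].
have := h2 e; rewrite e0 ed2 => /(_ isT) h2e.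
have := h1 e; rewrite e0 ed1 => /(_ isT) h1e.
rewrite /pv big_cons -/(pv s x) -h2e -h1e /trunc_integral.
have mD := measurable_far x e.
rewrite -RintegralZl //; last exact: integrable_trunc_piece.
rewrite -RintegralD //.
- congr Rintegral; apply/funext => y.
  by rewrite stepfE big_cons -stepfE mulrDl mulrA.
- exact: (@integrableZl _ _ _ mu _ mD t.1.1 _
    (integrable_trunc_piece t.1.2 t.2 x e0)).
- exact: integrable_trunc_stepf.
Qed.

Lemma hilbert_trunc_stepf s x : nonempty_pieces s -> x \notin endpoints s ->
  hilbert_trunc (stepf true s) x e @[e --> 0^'+] --> pi^-1 * pv s x.
Proof.
move=> ps xs; have [d d0 hd] := trunc_integral_stepf ps xs.
apply: cvg_near_cst; near=> e; rewrite /hilbert_trunc; congr (_ * _).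
apply: hd; apply/andP; split; near: e; first exact: nbhs_right_gt.
exact: nbhs_right_lt.
Unshelve. all: by end_near. Qed.

Lemma hilbert_stepf s x : nonempty_pieces s -> x \notin endpoints s ->
  hilbert (stepf true s) x = pi^-1 * pv s x.
Proof.
by move=> ps xs; apply: cvg_lim => //; exact: hilbert_trunc_stepf.
Qed.

Lemma negligible_endpoints s : mu.-negligible [set x | x \in endpoints s].
Proof.
elim: (endpoints s) => [|a l IH].
  rewrite (_ : [set x | _] = set0); first exact: negligible_set0.
  by apply/seteqP; split.
rewrite (_ : [set x | _] = [set a] `|` [set x | x \in l]).
  apply: negligibleU => //; apply/negligibleP; first exact: measurable_set1.
  exact: lebesgue_measure_set1.
by apply/seteqP; split => x /=; rewrite inE => /predU1P.
Qed.

Lemma hilbert_defined_stepf s : nonempty_pieces s -> hilbert_defined (stepf true s).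
Proof.
move=> ps; apply: negligibleS (negligible_endpoints s).
move=> x /= nx; apply: contrapT => xs; apply: nx; split.
  by move=> e e0; exact: integrable_trunc_stepf.
by apply/cvg_ex; exists (pi^-1 * pv s x); apply: hilbert_trunc_stepf => //; apply/negP.
Qed.

End hilbert_step.

(** * Self-similar construction *)

Section tiling.
Context {R : realType}.
Variables (H : nat) (K : seq nat).
Hypothesis H_gt0 : (0 < H)%N.
Hypothesis K_uniq : uniq K.
Implicit Types (s : seq (R * R * R)) (F : nat -> seq (R * R * R)).
Implicit Types (p q x a b g : R) (k i : nat).

Definition rescale g k (t : R * R * R) : R * R * R :=
  (g * t.1.1, (k%:R + t.1.2) / H%:R, (k%:R + t.2) / H%:R).

(** The data [F] may depend on the tile because in [good_data] the threshold left to a tile depends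
    on the gain of that tile. *)
Definition tiled g s F := s ++ flatten [seq map (rescale g k) (F k) | k <- K].

Definition in_tile k x := (k%:R / H%:R <= x) && (x < k.+1%:R / H%:R).

Let Hr_gt0 : 0 < H%:R :> R. Proof. by rewrite ltr0n. Qed.

Lemma big_tiled g s F (G : R * R * R -> R) :
  \sum_(t <- tiled g s F) G t =
  \sum_(t <- s) G t + \sum_(k <- K) \sum_(t <- F k) G (rescale g k t).
Proof.
rewrite big_cat big_flatten /= big_map; congr (_ + _).
by apply: eq_bigr => k _; rewrite big_map.
Qed.

Lemma mem_tiled g s F t : t \in tiled g s F ->
  t \in s \/ exists k u, [/\ k \in K, u \in F k & t = rescale g k u].
Proof.
rewrite mem_cat => /orP[|/flatten_mapP[k kK /mapP[u uF ->]]]; first by left.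
by right; exists k, u.
Qed.

Lemma inpiece_rescale c k a b x :
  inpiece c ((k%:R + a) / H%:R) ((k%:R + b) / H%:R) x =
  inpiece c a b (x * H%:R - k%:R).
Proof.
rewrite !inpieceE ltr_pdivlMr // ler_pdivrMr // ltr_pdivrMr //.
by rewrite lerBrDl ltrBrDl ltrBlDl.
Qed.

Lemma overlap_rescale k a b p q :
  overlap ((k%:R + a) / H%:R) ((k%:R + b) / H%:R) p q =
  overlap a b (p * H%:R - k%:R) (q * H%:R - k%:R) / H%:R.
Proof.
rewrite /overlap; apply: (canRL (mulfK _)); first by rewrite gt_eqF.
rewrite mulrC maxr_pMr ?ltW // mulr0 mulrBr minr_pMr ?ltW // maxr_pMr ?ltW //.
rewrite ![H%:R * _]mulrC !mulfVK ?gt_eqF //.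
congr Num.max.
rewrite -(addrK (- k%:R) (Num.min _ _)) -(addrK (- k%:R) (Num.max _ _)).
rewrite addr_minl addr_maxl.
rewrite (addrC k%:R b) addrK (addrC k%:R a) addrK; ring.
Qed.

Lemma stepf_tiled c g s F x :
  stepf c (tiled g s F) x =
  stepf c s x + \sum_(k <- K) g * stepf c (F k) (x * H%:R - k%:R).
Proof.
rewrite /stepf big_tiled; congr (_ + _); apply: eq_bigr => k _.
rewrite mulr_sumr; apply: eq_bigr => t _ /=.
by rewrite inpiece_rescale mulrA.
Qed.

Lemma mass_tiled g s F p q :
  mass (tiled g s F) p q =
  mass s p q +
  \sum_(k <- K) g / H%:R * mass (F k) (p * H%:R - k%:R) (q * H%:R - k%:R).
Proof.
rewrite /mass big_tiled; congr (_ + _); apply: eq_bigr => k _.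
rewrite mulr_sumr; apply: eq_bigr => t _ /=.
by rewrite overlap_rescale; ring.
Qed.

(** The logarithm of a ratio of distances is invariant under dilations, so a copy in a small tile
    produces as large a transform as the original. In [mass_tiled], by contrast, a factor 1 / H
    appears. *)
Lemma pv_tiled s F x :
  pv (tiled 1 s F) x =
  pv s x + \sum_(k <- K) pv (F k) (x * H%:R - k%:R).
Proof.
rewrite /pv big_tiled; congr (_ + _); apply: eq_bigr => k _.
apply: eq_bigr => t _ /=; rewrite mul1r; congr (_ * ln _).
have E a : x - (k%:R + a) / H%:R = (x * H%:R - k%:R - a) / H%:R.
  by field; rewrite gt_eqF.
by rewrite !E !normrM -mulf_div divff ?mulr1 // normr_eq0 invr_eq0 gt_eqF.
Qed.

Lemma within01_tiled g s F : {in K, forall k, (k < H)%N} ->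
  within01 s -> (forall k, within01 (F k)) -> within01 (tiled g s F).
Proof.
move=> KH s01 F01 t /mem_tiled[/s01 //|[k [u [kK uF ->]]]] /=.
have [h1 h2 h3] := F01 _ _ uF; have kH := KH _ kK.
split.
- by rewrite divr_ge0 // ?addr_ge0.
- by rewrite ler_pM2r ?invr_gt0 // lerD2l.
- rewrite ler_pdivrMr // mul1r (le_trans (lerD (lexx _) h3)) //.
  by rewrite natr1 ler_nat.
Qed.

Lemma pos_coef_tiled g s F : 0 <= g ->
  pos_coef s -> (forall k, pos_coef (F k)) -> pos_coef (tiled g s F).
Proof.
move=> g0 s0 F0 t /mem_tiled[/s0 //|[k [u [kK uF ->]]]] /=.
by rewrite mulr_ge0 // (F0 k).
Qed.

Lemma in_tileE k x : in_tile k x =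
  (0 <= x * H%:R - k%:R) && (x * H%:R - k%:R < 1).
Proof.
by rewrite /in_tile ler_pdivrMr // ltr_pdivlMr // subr_ge0 ltrBlDl natr1.
Qed.

Lemma in_tile_inj k i x : in_tile k x -> in_tile i x -> k = i.
Proof.
rewrite /in_tile => /andP[h1 h2] /andP[h3 h4].
have := le_lt_trans h1 h4; have := le_lt_trans h3 h2.
by rewrite !ltr_pM2r ?invr_gt0 // !ltr_nat; clear; lia.
Qed.

Lemma in_tile_exists x : 0 <= x < 1 -> exists2 k, (k < H)%N & in_tile k x.
Proof.
move=> /andP[x0 x1]; have xH0 : 0 <= x * H%:R by rewrite mulr_ge0.
have /andP[h1 h2] := truncn_itv xH0.
exists (Num.truncn (x * H%:R)).
  by rewrite -(@ltr_nat R) (le_lt_trans h1) // gtr_pMl.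
by rewrite /in_tile ler_pdivrMr // ltr_pdivlMr // h1.
Qed.

Lemma out_tile k i x : in_tile i x -> k != i ->
  (x * H%:R - k%:R < 0) || (1 <= x * H%:R - k%:R).
Proof.
move=> xi ki; rewrite ltNge [X in _ || X]leNgt -negb_and -in_tileE.
apply/negP => xk.
by rewrite (in_tile_inj xk xi) eqxx in ki.
Qed.

Lemma stepf_tiled_tile c g s F i x : (forall k, within01 (F k)) ->
  in_tile i x ->
  stepf c (tiled g s F) x =
  stepf c s x + (if i \in K then g * stepf c (F i) (x * H%:R - i%:R) else 0).
Proof.
move=> F01 xi; rewrite stepf_tiled; congr (_ + _).
have Z k : k != i -> g * stepf c (F k) (x * H%:R - k%:R) = 0.
  by move=> ki; rewrite stepf_out ?mulr0 // (out_tile xi).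
case: ifPn => iK.
  rewrite (bigD1_seq i) //= big1 ?addr0 // => k; exact: Z.
by rewrite big_seq big1 // => k kK; apply: Z; apply: contraNneq iK => <-.
Qed.

Lemma mass_tiled_tile g s F i p q : (forall k, within01 (F k)) ->
  i%:R / H%:R <= p -> q <= i.+1%:R / H%:R ->
  mass (tiled g s F) p q = mass s p q +
   (if i \in K then g / H%:R * mass (F i) (p * H%:R - i%:R) (q * H%:R - i%:R)
    else 0).
Proof.
move=> F01; rewrite ler_pdivrMr // ler_pdivlMr // => ip qi.
rewrite mass_tiled; congr (_ + _).
have Z k : k != i ->
    g / H%:R * mass (F k) (p * H%:R - k%:R) (q * H%:R - k%:R) = 0.
  move=> ki; rewrite mass_out ?mulr0 //.
  rewrite subr_le0 lerBrDl natr1; move: ki; rewrite neq_ltn => /orP[ki|ik].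
    by apply/orP; right; apply: le_trans ip; rewrite ler_nat.
  by apply/orP; left; apply: le_trans qi _; rewrite ler_nat.
case: ifPn => iK.
  rewrite (bigD1_seq i) //= big1 ?addr0 // => k; exact: Z.
by rewrite big_seq big1 // => k kK; apply: Z; apply: contraNneq iK => <-.
Qed.

End tiling.

(** * Martingale transforms of step functions *)

Section haar_step.
Context {R : realType}.
Local Notation mu := (@lebesgue_measure R).
Implicit Types (s : seq (R * R * R)) (x : R) (n k : nat).

Definition dpt n k : R := k%:R / (2 ^ n)%:R.

Definition jump s n k : R :=
  mass s (dpt n.+1 k.*2) (dpt n.+1 k.*2.+1) -
  mass s (dpt n.+1 k.*2.+1) (dpt n.+1 k.*2.+2).

Definition side n k x : R :=
  (inpiece true (dpt n.+1 k.*2) (dpt n.+1 k.*2.+1) x)%:R -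
  (inpiece true (dpt n.+1 k.*2.+1) (dpt n.+1 k.*2.+2) x)%:R.

Lemma dpt_double n k : dpt n.+1 k.*2 = dpt n k.
Proof.
rewrite /dpt -muln2 natrM expnSr natrM; field.
by rewrite !pnatr_eq0 -!lt0n expn_gt0.
Qed.

Lemma dyadicE n k : dyadic n k = piece true (dpt n k) (dpt n k.+1) :> set R.
Proof. by rewrite /dyadic /dyadic_itv /piece /dpt natrX. Qed.

Lemma haarE n k x : haar n k x = Num.sqrt (2 ^+ n) * side n k x.
Proof.
rewrite /haar /side !indicE !dyadicE -doubleS.
by rewrite !mem_setE.
Qed.

Lemma dyadic_subset n k : (k < 2 ^ n)%N ->
  piece true (dpt n k) (dpt n k.+1) `<=` unit_itv.
Proof.
move=> kn x; rewrite /piece /unit_itv /= !in_itv /= => /andP[h1 h2].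
have n0 : 0 < (2 ^ n)%:R :> R by rewrite ltr0n expn_gt0.
rewrite (le_trans _ h1) /=; last by rewrite divr_ge0.
by rewrite (le_trans (ltW h2)) // ler_pdivrMr // mul1r ler_nat.
Qed.

Lemma Rintegral_stepf_dyadic s n k : (k < 2 ^ n)%N ->
  \int[mu]_(x in unit_itv) (stepf true s x * \1_(piece true (dpt n k) (dpt n k.+1)) x) =
  mass s (dpt n k) (dpt n k.+1).
Proof.
move=> kn; rewrite /Rintegral.
transitivity (fine (\int[mu]_(x in unit_itv `&`
    piece true (dpt n k) (dpt n k.+1)) (stepf true s x)%:E)).
  rewrite integral_mkcondr; congr fine; apply: eq_integral => x _.
  rewrite /patch indicE; case: ifP => _; rewrite ?mulr1 ?mulr0 //.
rewrite setIidr; last exact: dyadic_subset.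
by rewrite integral_stepf_itv.
Qed.

Lemma integrable_stepf_dyadic s n k :
  mu.-integrable unit_itv
    (fun x => (stepf true s x * \1_(piece true (dpt n k) (dpt n k.+1)) x)%:E).
Proof.
have mU : measurable (unit_itv : set R) by exact: measurable_itv.
have H := @integrable_stepf _ true s _ mU.
refine (@le_integrable _ _ _ mu _ mU _ _ _ _ H).
  apply/measurable_EFinP; apply: measurable_funM; first exact: measurable_stepf.
  by apply: measurable_indic; exact: measurable_piece.
move=> x _; rewrite lee_fin normrM ler_piMr // indicE.
by case: (_ \in _); rewrite ?normr1 ?normr0.
Qed.

Lemma haar_coefE s n k : (k < 2 ^ n)%N ->
  haar_coef (stepf true s) n k = Num.sqrt (2 ^+ n) * jump s n k.
Proof.
move=> kn; rewrite /haar_coef.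
have mU : measurable (unit_itv : set R) by exact: measurable_itv.
have kn1 : (k.*2.+1 < 2 ^ n.+1)%N by rewrite expnS; lia.
have kn2 : (k.*2 < 2 ^ n.+1)%N by rewrite expnS; lia.
rewrite /jump -!Rintegral_stepf_dyadic // -RintegralB //;
  [|exact: integrable_stepf_dyadic..].
rewrite -RintegralZl //; last first.
  have := @integrableB _ _ _ mu _ mU _ _ (integrable_stepf_dyadic s n.+1 k.*2)
     (integrable_stepf_dyadic s n.+1 k.*2.+1).
  by [].
have ind a b x : (inpiece true a b x)%:R = \1_(piece true a b) x :> R.
  by rewrite indicE mem_setE.
by apply: eq_Rintegral => x _; rewrite haarE /side !ind; ring.
Qed.

(** The generation [n] part of the martingale transform. The factor [2 ^ n] is the product of the
    two normalizations [Num.sqrt (2 ^+ n)], one from the coefficient and one from the Haar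
    function. *)
Definition layer (eps : nat -> nat -> R) s n x : R :=
  \sum_(0 <= k < 2 ^ n) eps n k * ((2 ^ n)%:R * jump s n k) * side n k x.

Lemma martingale_partialE eps s x N :
  martingale_partial eps (stepf true s) x N = \sum_(0 <= n < N) layer eps s n x.
Proof.
apply: eq_bigr => n _; apply: eq_big_nat => k /andP[_ kn].
rewrite haar_coefE // haarE natrX -{3}[2 ^+ n]sqr_sqrtr ?exprn_ge0 //.
by ring.
Qed.

Lemma martingale_stepf eps s x N0 :
  (forall n k, (N0 <= n)%N -> eps n k = 0) ->
  martingale_partial eps (stepf true s) x N @[N --> \oo] -->
  \sum_(0 <= n < N0) layer eps s n x.
Proof.
move=> eps0; apply: cvg_near_cst; near=> N.
have NN : (N0 <= N)%N by near: N; exact: nbhs_infty_ge.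
rewrite martingale_partialE (big_cat_nat _ NN) //= [X in _ + X]big_nat_cond.
rewrite [X in _ + X]big1 ?addr0 // => n /andP[/andP[n0 _] _].
by rewrite /layer big1 // => k _; rewrite eps0 // !mul0r.
Unshelve. all: by end_near. Qed.

Lemma martingale_defined_stepf eps s N0 :
  (forall n k, (N0 <= n)%N -> eps n k = 0) ->
  martingale_defined eps (stepf true s).
Proof.
move=> eps0; split.
  by apply: integrable_stepf; exact: measurable_itv.
apply: aeW => x _; apply/cvg_ex.
by exists (\sum_(0 <= n < N0) layer eps s n x); exact: martingale_stepf.
Qed.


Lemma side_out n k x : ~~ in_tile (2 ^ n) k x -> side n k x = 0.
Proof.
have n0 : 0 < (2 ^ n.+1)%:R^-1 :> R by rewrite invr_gt0 ltr0n expn_gt0.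
rewrite /side !inpieceE /in_tile -/(dpt n k) -/(dpt n k.+1).
rewrite -(dpt_double n k) -(dpt_double n k.+1) doubleS.
have h1 : dpt n.+1 k.*2 < dpt n.+1 k.*2.+1 by rewrite ltr_pM2r // ltr_nat.
have h2 : dpt n.+1 k.*2.+1 < dpt n.+1 k.*2.+2 by rewrite ltr_pM2r // ltr_nat.
move=> xk.
have -> : (dpt n.+1 k.*2 <= x) && (x < dpt n.+1 k.*2.+1) = false.
  by apply: contraNF xk => /andP[-> h4]; exact: lt_trans h2.
have -> : (dpt n.+1 k.*2.+1 <= x) && (x < dpt n.+1 k.*2.+2) = false.
  by apply: contraNF xk => /andP[h3 ->]; rewrite andbT (le_trans _ h3) // ltW.
by rewrite subrr.
Qed.

Lemma layer_single eps s n k x : (k < 2 ^ n)%N -> in_tile (2 ^ n) k x ->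
  layer eps s n x = eps n k * ((2 ^ n)%:R * jump s n k) * side n k x.
Proof.
move=> kn xk; rewrite /layer (bigD1_seq k) ?iota_uniq ?mem_index_iota //=.
rewrite big1 ?addr0 // => i ik; rewrite side_out ?mulr0 //.
apply: contraNN ik => xi; apply/eqP; apply: in_tile_inj xi xk.
by rewrite expn_gt0.
Qed.

(** Here the signs, and not the position of [x], single out one interval, so [x] may also lie
    outside of it. *)
Lemma layer_single_eps eps s n k x : (k < 2 ^ n)%N ->
  (forall i, (i < 2 ^ n)%N -> i != k -> eps n i = 0) ->
  layer eps s n x = eps n k * ((2 ^ n)%:R * jump s n k) * side n k x.
Proof.
move=> kn eps0; rewrite /layer (bigD1_seq k) ?iota_uniq ?mem_index_iota //=.
rewrite big_nat_cond big1 ?addr0 // => i /andP[/andP[_ iN] ik].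
by rewrite eps0 ?mul0r.
Qed.

End haar_step.

(** * Combinatorics of the shells and of the kept tiles *)

Section shells.
Variable L : nat.
Local Notation H := (4 ^ L)%N.

(* In units of tiles of length 4 ^ -L, shell j, namely
   [1/2 + 4^-j/2, 1/2 + 4^-j), is [2 4^(L-1) + n, 2 4^(L-1) + 2 n) with
   n = shell_width j. *)
Definition shell_width j := (2 * 4 ^ (L - j.+1))%N.

Definition in_shell j k :=
  (2 * 4 ^ L.-1 + shell_width j <= k < 2 * 4 ^ L.-1 + 2 * shell_width j)%N.

Definition is_tile k := has (fun j => in_shell j k) (iota 2 (L - 2)).

Definition tiles := [seq k <- iota 0 H | is_tile k].

(* A lower bound, 4^j / 2 on shell j, for what one generation of f adds to
   either transform. *)
Definition gain {R : realType} k : R :=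
  \sum_(2 <= j < L) (in_shell j k)%:R * (4 ^+ j / 2).

Hypothesis L_gt2 : (2 < L)%N.

Lemma half_H : (2 * (2 * 4 ^ L.-1) = H)%N.
Proof. by case: L L_gt2 => // l _; rewrite expnS /= mulnA. Qed.

Lemma shell_widthE j : (j < L)%N -> (2 * shell_width j * 4 ^ j = H)%N.
Proof.
by move=> jL; rewrite /shell_width !mulnA -[(2 * 2)%N]/4%N -expnS -expnD; congr expn; lia.
Qed.

Lemma shell_width_lt i j : (i < j < L)%N -> (2 * shell_width j <= shell_width i)%N.
Proof.
move=> /andP[ij jL]; rewrite /shell_width leq_mul2l /=.
apply: (@leq_trans (4 ^ (L - j.+1).+1)); first by rewrite expnS leq_mul2r orbT.
by rewrite leq_exp2l //; lia.
Qed.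

Lemma shell_width_ge2 j : (2 <= shell_width j)%N.
Proof. by rewrite /shell_width leq_pmulr // expn_gt0. Qed.

Lemma is_tileP k :
  reflect (exists2 j, (2 <= j < L)%N & in_shell j k) (is_tile k).
Proof.
apply: (iffP hasP) => -[j jL jk]; exists j => //; move: jL; rewrite mem_iota; clear; lia.
Qed.

(** The widths at least halve from one shell to the next, so the shell with the larger index ends
    before the other one begins. *)
Lemma in_shell_inj i j k : (2 <= i < L)%N -> (2 <= j < L)%N ->
  in_shell i k -> in_shell j k -> i = j.
Proof.
move=> iL jL; rewrite /in_shell => ki kj; apply/eqP; apply: contraT.
rewrite neq_ltn => /orP[ij|ji].
- have := @shell_width_lt i j; lia.
- have := @shell_width_lt j i; lia.
Qed.

(** Every width is at least 2, which leaves two free tiles to the right of 1/2: the positive mass of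
    f occupies the first. The outermost shell is shell 2, which ends at 1/2 + 4^-2 = 9/16. *)
Lemma shell_range j k : (2 <= j < L)%N -> in_shell j k ->
  (2 * 4 ^ L.-1 + 2 <= k)%N /\ (16 * k.+1 <= 9 * H)%N.
Proof.
move=> jL; rewrite /in_shell; have := shell_width_ge2 j.
have := @shell_widthE 2 L_gt2; have := half_H.
have [->|j2] := eqVneq j 2%N; first lia.
have := @shell_width_lt 2 j; lia.
Qed.

Lemma in_shell_ltH j k : (2 <= j < L)%N -> in_shell j k -> (k < H)%N.
Proof. by move=> jL jk; have [_] := shell_range jL jk; lia. Qed.

Lemma mem_tiles k : (k \in tiles) = is_tile k.
Proof.
rewrite mem_filter mem_iota add0n /=.
case: is_tileP => //= -[j jL jk]; exact: in_shell_ltH jk.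
Qed.

Lemma tiles_uniq : uniq tiles.
Proof. by rewrite filter_uniq ?iota_uniq. Qed.

Lemma tiles_ltH : {in tiles, forall k, (k < H)%N}.
Proof. by move=> k; rewrite mem_filter mem_iota => /andP[]. Qed.

Lemma size_tiles_le : (size tiles <= H)%N.
Proof. by rewrite size_filter (leq_trans (count_size _ _)) ?size_iota. Qed.

Lemma size_shell j : (2 <= j < L)%N ->
  (shell_width j <= size [seq k <- tiles | in_shell j k])%N.
Proof.
move=> jL; rewrite -[X in (X <= _)%N](size_iota (2 * 4 ^ L.-1 + shell_width j)).
apply: uniq_leq_size; first exact: iota_uniq.
move=> k; rewrite mem_iota => hk; have jk : in_shell j k by rewrite /in_shell; lia.
by rewrite mem_filter jk mem_tiles; apply/is_tileP; exists j.
Qed.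

(** Shell 2 alone has relative measure 4^-2 / 2 = 1/32. *)
Lemma size_tiles_ge : (H <= 32 * size tiles)%N.
Proof.
have := @size_shell 2 L_gt2; have := @shell_widthE 2 L_gt2.
have : (size [seq k <- tiles | in_shell 2 k] <= size tiles)%N.
  by rewrite size_filter count_size.
lia.
Qed.

Context {R : realType}.

Lemma gainE j k : (2 <= j < L)%N -> in_shell j k -> gain k = 4 ^+ j / 2 :> R.
Proof.
move=> jL jk; rewrite /gain (bigD1_seq j) ?iota_uniq //=; last first.
  by rewrite mem_index_iota.
rewrite jk mul1r big_nat_cond big1 ?addr0 // => i /andP[iL ij].
case: (boolP (in_shell i k)) => [ik|]; last by rewrite mul0r.
by rewrite (in_shell_inj iL jL ik jk) eqxx in ij.
Qed.

Lemma gain_ge0 k : 0 <= gain k :> R.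
Proof. by apply: sumr_ge0 => j _; rewrite mulr_ge0 // divr_ge0 // exprn_ge0. Qed.

Lemma gain_le k : is_tile k -> gain k <= H%:R :> R.
Proof.
move=> /is_tileP[j jL jk]; rewrite (gainE jL jk) natrX.
have h : (4 : R) ^+ j <= 4 ^+ L by rewrite ler_eXn2l //; [lia | lra].
have : 0 <= (4 : R) ^+ j by rewrite exprn_ge0.
by move: h; set u := 4 ^+ j; set v := 4 ^+ L; lra.
Qed.

(** Shell [j] has at least [shell_width j] tiles, each of gain 4^j / 2, and the product of the two
    is H / 4 for every [j]: the [L - 2] scales contribute equally. *)
Lemma sum_gain : (L - 2)%:R / 4 * H%:R <= \sum_(k <- tiles) gain k :> R.
Proof.
rewrite /gain exchange_big /=.
rewrite [leLHS](_ : _ = \sum_(2 <= j < L) (H%:R / 4)); last first.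
  by rewrite sumr_const_nat -mulr_natl; field.
apply: ler_sum_nat => j jL.
rewrite -mulr_suml.
have -> : \sum_(k <- tiles) (in_shell j k)%:R =
   (size [seq k <- tiles | in_shell j k])%:R :> R.
  rewrite size_filter -sum1_count natr_sum [RHS]big_mkcond /=.
  by apply: eq_bigr => k _; case: in_shell.
apply: (@le_trans _ _ ((shell_width j)%:R * (4 ^+ j / 2))).
  rewrite -(shell_widthE (proj2 (andP jL))) !(natrM _ _ (4 ^ j)) (natrX _ 4 j).
  rewrite (natrM _ 2); set u := (shell_width j)%:R; set v := _ ^+ j.
  by rewrite le_eqVlt; apply/orP; left; apply/eqP; field.
by rewrite ler_wpM2r ?ler_nat ?size_shell // divr_ge0 // exprn_ge0.
Qed.

End shells.

(** * Recursive construction of f, of the weight and of the good set *)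

Section construction.
Context {R : realType}.
Variable L : nat.
Implicit Types (x p q s t : R) (N i k : nat).
Local Notation H := (4 ^ L)%N.
Local Notation K := (tiles L).

Definition dens : R := H%:R / (size K)%:R.

Definition f_base : seq (R * R * R) :=
  [:: (- 4, 0, 4^-1); (H%:R, 2^-1, 2^-1 + H%:R^-1)].

(** Copies of f keep their amplitude while copies of the weight are multiplied by [dens]. Thus the
    transform gains equally at every generation, and every generation costs equally in the weighted
    norm. *)
Fixpoint f_data N : seq (R * R * R) :=
  if N is N'.+1 then tiled H K 1 f_base (fun=> f_data N') else [::].

Variable Q : R.

(** The base region is listed tile by tile, so that [sum_overlap] compares its mass with Lebesgue
    measure term by term. *)
Definition w_base : seq (R * R * R) :=
  [seq rescale H Q^-1 k (1, 0, 1) | k <- iota 0 H & ~~ is_tile L k].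

Fixpoint w_data N : seq (R * R * R) :=
  if N is N'.+1 then tiled H K dens w_base (fun=> w_data N') else [:: (1, 0, 1)].

(* Dominates the product of |f| and the weight. *)
Definition e_base : seq (R * R * R) :=
  [:: (4 / Q, 0, 4^-1); (H%:R / Q, 2^-1, 2^-1 + H%:R^-1)].

Fixpoint e_data N : seq (R * R * R) :=
  if N is N'.+1 then tiled H K dens e_base (fun=> e_data N') else [::].

(* The restriction of the weight to the intervals of the last generation along
   which the gains add up to more than s. *)
Fixpoint good_data N (s : R) : seq (R * R * R) :=
  if N is N'.+1 then tiled H K dens [::] (fun k => good_data N' (s - gain L k))
  else if s < 0 then [:: (1, 0, 1)] else [::].

Hypothesis L_gt2 : (2 < L)%N.
Hypothesis Q_ge1 : 1 <= Q.

Let Hn_gt0 : (0 < H)%N. Proof. by rewrite expn_gt0. Qed.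

Let H_gt0 : 0 < H%:R :> R. Proof. by rewrite ltr0n. Qed.

Lemma H_ge64 : 64 <= H%:R :> R.
Proof.
rewrite ler_nat -[64%N]/(4 ^ 3)%N; exact: (leq_pexp2l _ L_gt2).
Qed.

Let Hinv : 0 < (H%:R^-1 : R) /\ 64 * (H%:R^-1 : R) <= 1.
Proof. by rewrite invr_gt0 H_gt0 ler_pdivrMr // mul1r H_ge64. Qed.

Let Q_gt0 : 0 < Q. Proof. exact: lt_le_trans Q_ge1. Qed.

Let Qinv : 0 < Q^-1 <= 1.
Proof. by rewrite invr_gt0 Q_gt0 invf_le1. Qed.

Lemma size_tiles_gt0 : 0 < (size K)%:R :> R.
Proof. by rewrite ltr0n; have := size_tiles_ge L_gt2; lia. Qed.

Lemma dens_ge1 : 1 <= dens.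
Proof. by rewrite ler_pdivlMr ?size_tiles_gt0 // mul1r ler_nat size_tiles_le. Qed.

Lemma dens_le32 : dens <= 32.
Proof.
by rewrite ler_pdivrMr ?size_tiles_gt0 // -natrM ler_nat size_tiles_ge.
Qed.

Lemma dens_size : dens / H%:R * (size K)%:R = 1.
Proof. by rewrite /dens; field; rewrite !gt_eqF // size_tiles_gt0. Qed.

Let dens_ge0 : 0 <= dens. Proof. by rewrite (le_trans _ dens_ge1). Qed.

Lemma within01_f N : within01 (f_data N).
Proof.
elim: N => [//|N IH]; apply: within01_tiled => //; first exact: tiles_ltH.
by have [h1 h2] := Hinv; move=> t; rewrite !inE => /orP[/eqP ->|/eqP ->] /=; split; lra.
Qed.

Lemma within01_w N : within01 (w_data N).
Proof.
elim: N => [|N IH] /=; first by move=> t; rewrite inE => /eqP -> /=; split.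
apply: within01_tiled => //; first exact: tiles_ltH.
move=> t /mapP[k]; rewrite mem_filter mem_iota add0n => /and3P[_ _ kH] -> /=.
rewrite addr0 natr1 divr_ge0 // ler_pM2r ?invr_gt0 // ler_nat leqnSn.
by rewrite ler_pdivrMr // mul1r ler_nat.
Qed.

Lemma within01_e N : within01 (e_data N).
Proof.
elim: N => [//|N IH]; apply: within01_tiled => //; first exact: tiles_ltH.
by have [h1 h2] := Hinv; move=> t; rewrite !inE => /orP[/eqP ->|/eqP ->] /=; split; lra.
Qed.

Lemma within01_good N s : within01 (good_data N s).
Proof.
elim: N s => [|N IH] s /=.
  by case: ifP => _ // t; rewrite inE => /eqP -> /=; split.
by apply: within01_tiled => //; first exact: tiles_ltH.
Qed.

Lemma pos_w N : pos_coef (w_data N).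
Proof.
elim: N => [|N IH] /=; first by move=> t; rewrite inE => /eqP -> /=.
apply: pos_coef_tiled => // t /mapP[k _ ->] /=.
by rewrite mulr1 invr_ge0 ltW.
Qed.

Lemma pos_e N : pos_coef (e_data N).
Proof.
elim: N => [//|N IH]; apply: pos_coef_tiled => // t.
by rewrite !inE => /orP[/eqP ->|/eqP ->] /=; rewrite divr_ge0 // ltW.
Qed.

Lemma pos_good N s : pos_coef (good_data N s).
Proof.
elim: N s => [|N IH] s /=.
  by case: ifP => _ // t; rewrite inE => /eqP -> /=.
by apply: pos_coef_tiled.
Qed.

Lemma tile_bounds k x : k \in K -> in_tile H k x ->
  2^-1 + 2 * H%:R^-1 <= x /\ x < 9 / 16.
Proof.
rewrite mem_tiles // => /is_tileP[j jL jk]; have [h1 h2] := shell_range L_gt2 jL jk.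
move=> /andP[]; rewrite ler_pdivrMr // ltr_pdivlMr // => kx xk.
have e : (2 * (2 * 4 ^ L.-1) = H)%N by exact: half_H.
split.
- rewrite -(ler_pM2r H_gt0) mulrDl -mulrA mulVf ?gt_eqF // mulr1.
  apply: le_trans kx; move: h1; rewrite -(ler_nat R) natrD => h1.
  apply: le_trans h1; rewrite lerD2r -[in leLHS]e natrM mulrA mulVf // mul1r //.
- rewrite -(ltr_pM2r H_gt0) (lt_le_trans xk) //.
  by move: h2; rewrite -(ler_nat R) !natrM => h2; lra.
Qed.

(** * Values and masses of the weight, and its [A_1] property *)

Lemma stepf_w_base x i : (i < H)%N -> in_tile H i x ->
  stepf true w_base x = if i \in K then 0 else Q^-1.
Proof.
move=> iH xi; rewrite /stepf big_map big_filter.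
have E k : inpiece true ((k%:R + 0) / H%:R) ((k%:R + 1) / H%:R) x = in_tile H k x.
  by rewrite inpieceE addr0 natr1.
have Z k : k != i -> Q^-1 * 1 * (inpiece true ((k%:R + 0) / H%:R) ((k%:R + 1) / H%:R) x)%:R = 0.
  move=> ki; rewrite E; case: (boolP (in_tile H k x)) => [xk|]; last by rewrite mulr0.
  by rewrite (in_tile_inj Hn_gt0 xk xi) eqxx in ki.
rewrite mem_tiles //; case: ifPn => it.
  rewrite big_seq_cond big1 // => k /andP[_ kt]; apply: Z.
  by apply: contraNneq kt => ->.
rewrite big_mkcond (bigD1_seq i) ?iota_uniq ?mem_iota //= it E xi !mulr1.
rewrite big1 ?addr0 // => k ki; case: ifP => // _.
by rewrite -[Q^-1]mulr1; exact: Z.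
Qed.

Lemma stepf_w_tile N x i : (i < H)%N -> in_tile H i x ->
  stepf true (w_data N.+1) x =
  if i \in K then dens * stepf true (w_data N) (x * H%:R - i%:R) else Q^-1.
Proof.
move=> iH xi; rewrite /= (stepf_tiled_tile _ _ _ _ _ _ xi) ?tiles_uniq //; last first.
  by move=> _; exact: within01_w.
by rewrite (stepf_w_base iH xi); case: ifP => _; rewrite ?add0r ?addr0.
Qed.

(** Passing to a kept tile multiplies the weight by [dens], which is at least 1. *)
Lemma w_ge N x : 0 <= x < 1 -> Q^-1 <= stepf true (w_data N) x.
Proof.
elim: N x => [|N IH] x x01.
  by rewrite /stepf big_seq1 /= inpieceE x01 mulr1; case/andP: Qinv.
have [i iH xi] := in_tile_exists Hn_gt0 x01.
rewrite (stepf_w_tile _ iH xi); case: ifP => // _.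
have [Q0 _] := andP Qinv.
rewrite -[leLHS]mul1r; apply: ler_pM; rewrite ?dens_ge1 ?(ltW Q0) //.
by apply: IH; rewrite -in_tileE.
Qed.

Lemma sum_overlap n p q :
  \sum_(k <- iota 0 n) overlap ((k%:R + 0) / H%:R) ((k%:R + 1) / H%:R) p q =
  overlap 0 (n%:R / H%:R) p q :> R.
Proof.
elim: n => [|n IH].
  rewrite big_nil mul0r /overlap; apply/esym/max_idPl.
  by rewrite subr_le0 ge_min le_max lexx.
rewrite -[n.+1]addn1 iotaD add0n big_cat IH big_seq1 addr0 natr1 addn1.
apply: overlap_split; first by rewrite divr_ge0.
by rewrite ler_pM2r ?invr_gt0 // ler_nat.
Qed.

Lemma mass_w_base_le p q : mass w_base p q <= overlap 0 1 p q.
Proof.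
have -> : overlap 0 1 p q = overlap 0 (H%:R / H%:R) p q by rewrite divff ?gt_eqF.
rewrite -sum_overlap /mass big_map big_filter big_mkcond /=.
apply: ler_sum => k _; case: ifP => _; last exact: overlap_ge0.
by rewrite mulr1 ler_piMl ?overlap_ge0 //; case/andP: Qinv.
Qed.

(** By [dens_size], tiling preserves the mass of the previous generation, so each generation only
    adds the mass of its base region, at most 1 / Q. This is why up to Q generations keep the total
    mass between 1 and 2. *)
Lemma mass_w_total N :
  mass (w_data N) 0 1 = 1 + N%:R * (1 - (size K)%:R / H%:R) / Q.
Proof.
elim: N => [|N IH].
  by rewrite /mass big_seq1 /= overlap_full // mul0r mul0r addr0 subr0 mulr1.
rewrite mass_tiled //.
have -> : mass w_base 0 1 = (1 - (size K)%:R / H%:R) / Q.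
  rewrite /mass big_map big_filter.
  transitivity (\sum_(k <- iota 0 H | ~~ is_tile L k) (Q^-1 / H%:R)).
    rewrite big_seq_cond [RHS]big_seq_cond; apply: eq_bigr => k.
    rewrite mem_iota add0n => /andP[kH _] /=.
    rewrite overlap_full ?addr0 ?natr1 ?divr_ge0 //.
    - by rewrite -mulrBl -natr1 [_ + 1]addrC addrK mulr1 mul1r.
    - by rewrite ler_pM2r ?invr_gt0 // ler_nat.
    - by rewrite ler_pdivrMr // mul1r ler_nat.
  rewrite big_const_seq iter_addr_0 -mulr_natl.
  have : (count (predC (is_tile L)) (iota 0 H) + size K = H)%N.
    by rewrite size_filter addnC count_predC size_iota.
  move=> /(congr1 (fun n => n%:R : R)); rewrite natrD.
  rewrite (_ : count _ _ = count (fun i => ~~ is_tile L i) (iota 0 H)) // => <-.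
  set a := _%:R; have ah : a + (size K)%:R != 0 :> R.
    by rewrite gt_eqF // ltr_wpDl // size_tiles_gt0.
  by field; rewrite ah gt_eqF.
rewrite (eq_big_seq (fun=> dens / H%:R * mass (w_data N) 0 1)); last first.
  move=> k kK; congr (_ * _); apply: mass_total; first exact: within01_w.
    by rewrite mul0r sub0r oppr_le0.
  by rewrite mul1r lerBrDl natr1 ler_nat tiles_ltH.
rewrite big_const_seq count_predT iter_addr_0 -(mulr_natr (dens / _ * _)).
by rewrite (mulrAC (dens / _)) dens_size mul1r IH -natr1; field; rewrite !gt_eqF.
Qed.


Lemma mass_w_bounds N p q : N%:R <= Q ->
  mass (w_data N) p q <= 2 /\ 1 <= mass (w_data N) 0 1.
Proof.
move=> NQ.
have r01 : 0 <= ((size K)%:R / H%:R : R) <= 1.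
  by rewrite divr_ge0 //= ler_pdivrMr // mul1r ler_nat size_tiles_le.
move: (mass_w_total N); set r := _ / H%:R; have /andP[r0 r1] : 0 <= r <= 1 by [].
move=> e; have : 0 <= N%:R * (1 - r) / Q <= 1.
  rewrite divr_ge0 ?mulr_ge0 ?subr_ge0 ?(ltW Q_gt0) //= ler_pdivrMr // mul1r.
  by rewrite (le_trans _ NQ) // ler_piMr //; lra.
move=> /andP[h1 h2]; split; last by rewrite e; lra.
by rewrite (le_trans (mass_le_total _ _ (@within01_w N) (@pos_w N))) // e; lra.
Qed.

(* The kept tiles lie in [1/2, 9/16]: an interval leaving [0, 1] must cross a
   region of low weight before it meets them. *)
Lemma mass_w_boundary N p q : N%:R <= Q -> p <= q -> (p <= 0) || (1 <= q) ->
  mass (w_data N) p q <= 5 * overlap 0 1 p q.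
Proof.
case: N => [|N] NQ pq hpq.
  rewrite /mass big_seq1 /= mul1r ler_peMl ?overlap_ge0 //; lra.
have [far|] := boolP ((q <= 2^-1) || (9 / 16 <= p)).
  rewrite mass_tiled // big_seq big1 ?addr0 => [|k kK].
    rewrite (le_trans (mass_w_base_le _ _)) // ler_peMl ?overlap_ge0 //; lra.
  rewrite mass_out ?mulr0 //; first exact: within01_w.
  have kt : in_tile H k (k%:R / H%:R : R).
    by rewrite /in_tile lexx /= ltr_pM2r ?invr_gt0 // ltr_nat ltnSn.
  case/orP: far => h; apply/orP; [left|right].
    have [h1 _] := tile_bounds kK kt; have [h2 _] := Hinv.
    rewrite subr_le0 -ler_pdivlMr // (le_trans h) // (le_trans _ h1) //; lra.
  have [j jL jk] := is_tileP _ _ (etrans (esym (mem_tiles L_gt2 k)) kK).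
  have [_ h2] := shell_range L_gt2 jL jk.
  rewrite lerBrDl natr1 -ler_pdivrMr // (le_trans _ h) // ler_pdivrMr //.
  by move: h2; rewrite -(ler_nat R) !natrM; lra.
(* Now the interval starts before 9/16, ends after 1/2 and leaves (0, 1), so it covers at least 7/16
   of [0, 1]. The constant 5 is chosen so that 5 * 7/16 exceeds the bound 2 on the total mass. *)
rewrite negb_or -!ltNge => /andP[h1 h2].
have [m2 _] := mass_w_bounds p q NQ.
apply: (le_trans m2); rewrite /overlap.
by case/orP: hpq => hpq; case: (leP 1 q) => ?; case: (leP 0 p) => ?;
  case: (leP 0 (_ - _)) => ?; lra.
Qed.

(** Induction on generations. An interval inside a kept tile is rescaled to the previous generation.
    Any other interval sticks out of every kept tile that it meets, so [mass_w_boundary] makes its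
    mass comparable to its length, and [w_ge] supplies Q w >= 1. The constant 160 is 5 times the
    bound 32 on [dens]. *)
Lemma mass_w_A1 N p q x : N%:R <= Q -> p <= x -> x < q -> 0 <= x < 1 ->
  mass (w_data N) p q <= 160 * Q * stepf true (w_data N) x * (q - p).
Proof.
have Q0 := Q_gt0.
elim: N p q x => [|N IH] p q x NQ px xq x01.
  have pq : p <= q by rewrite (le_trans px) ?ltW.
  rewrite /mass /stepf !big_seq1 /= inpieceE x01 mulr1 mul1r.
  rewrite (le_trans (overlap_le _ _ pq)) // ler_peMl ?subr_ge0 //.
  have := Q_ge1; lra.
have pq : p <= q by rewrite (le_trans px) ?ltW.
have NQ' : N%:R <= Q by rewrite (le_trans _ NQ) // ler_nat.
have [/hasP[k kK /andP[kp qk]]|/hasPn nin] :=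
    boolP (has (fun k => (k%:R / H%:R <= p) && (q <= k.+1%:R / H%:R)) K).
  have xk : in_tile H k x by rewrite /in_tile (le_trans kp) //= (lt_le_trans xq).
  have kH := tiles_ltH kK.
  rewrite (stepf_w_tile _ kH xk) kK (@mass_tiled_tile _ _ _ _ _ _ _ _ k) //;
    [|exact: tiles_uniq|by move=> _; exact: within01_w].
  rewrite kK [X in X + _](_ : _ = 0) ?add0r; last first.
    rewrite /mass big_map big_filter big_seq_cond big1 // => i /andP[_ it] /=.
    rewrite overlap_eq0 ?mulr0 // addr0 natr1.
    have : i != k by apply: contraNneq it => ->; rewrite -mem_tiles.
    rewrite neq_ltn => /orP[ik|ki].
      by rewrite (le_trans _ kp) // ler_pM2r ?invr_gt0 // ler_nat.
    by rewrite (le_trans qk) ?orbT // ler_pM2r ?invr_gt0 // ler_nat.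
  set x' := x * H%:R - k%:R.
  have := IH (p * H%:R - k%:R) (q * H%:R - k%:R) x' NQ'.
  rewrite lerD2r ler_pM2r // ltrD2r ltr_pM2r // => /(_ px xq).
  rewrite -in_tileE // => /(_ xk) h.
  apply: (le_trans (ler_wpM2l _ h)); first by rewrite divr_ge0.
  rewrite le_eqVlt; apply/orP; left; apply/eqP.
  by field; rewrite gt_eqF.
(* Second case: the interval is contained in no kept tile. It remains to bound its mass by 160 times
   its length. *)
have hw := w_ge N.+1 x01.
have Qw : 1 <= Q * stepf true (w_data N.+1) x.
  by rewrite -ler_pdivrMl // mulr1.
apply: (@le_trans _ _ (160 * (q - p))); last first.
  by rewrite ler_wpM2r ?subr_ge0 // -mulrA ler_peMr.
apply: (@le_trans _ _ (5 * dens * overlap 0 1 p q)); last first.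
  have h1 := dens_le32; have h2 := dens_ge1.
  by apply: ler_pM; rewrite ?overlap_ge0 ?overlap_le //; lra.
have -> : overlap 0 1 p q = overlap 0 (H%:R / H%:R) p q by rewrite divff ?gt_eqF.
rewrite -sum_overlap mulr_sumr [leRHS](bigID (is_tile L)) /= addrC mass_tiled //.
apply: lerD.
  rewrite /mass big_map big_filter; apply: ler_sum => k _.
  apply: ler_wpM2r; first exact: overlap_ge0.
  have [_ h] := andP Qinv; have h2 := dens_ge1; rewrite /= mulr1; lra.
rewrite big_filter big_mkcond [leRHS]big_mkcond /= big_seq [leRHS]big_seq.
apply: ler_sum => k kH; case: ifP => // kt.
have kK : k \in K by rewrite mem_tiles.
rewrite overlap_rescale //.
rewrite [leRHS](_ : _ = dens / H%:R *
  (5 * overlap 0 1 (p * H%:R - k%:R) (q * H%:R - k%:R))); last by ring.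
apply: ler_wpM2l; first by rewrite divr_ge0.
apply: mass_w_boundary => //; first by rewrite lerD2r ler_pM2r.
(* In the coordinates of tile [k], not being contained in the tile means reaching below 0 or above
   1. *)
have := nin _ kK; rewrite negb_and -!ltNge => /orP[h|h]; apply/orP; [left|right].
  by rewrite subr_le0 -ler_pdivlMr // ltW.
by rewrite lerBrDl natr1 -ler_pdivrMr // ltW.
Qed.

(** * Weighted norm of f and mass of the good set *)

Lemma base_tile_eq0 c (u v : R) k x : k \in K -> in_tile H k x ->
  stepf c [:: (u, 0, 4^-1); (v, 2^-1, 2^-1 + H%:R^-1)] x = 0.
Proof.
move=> kK kx; have [h1 _] := tile_bounds kK kx; have [h2 _] := Hinv.
rewrite /stepf big_cons big_seq1 !inpieceE /= (ltNge x) (ltNge x (_ + _)).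
have -> : 4^-1 <= x by lra.
have -> : 2^-1 + H%:R^-1 <= x by lra.
by rewrite !andbF !mulr0 addr0.
Qed.

Lemma stepf_f_tile N x i : in_tile H i x ->
  stepf true (f_data N.+1) x = stepf true (f_base) x +
  (if i \in K then stepf true (f_data N) (x * H%:R - i%:R) else 0).
Proof.
move=> xi; rewrite /= (stepf_tiled_tile _ _ _ _ _ _ xi) ?tiles_uniq ?mul1r //.
by move=> _; exact: within01_f.
Qed.

Lemma stepf_e_tile N x i : in_tile H i x ->
  stepf true (e_data N.+1) x = stepf true (e_base) x +
  (if i \in K then dens * stepf true (e_data N) (x * H%:R - i%:R) else 0).
Proof.
move=> xi; rewrite /= (stepf_tiled_tile _ _ _ _ _ _ xi) ?tiles_uniq //.
by move=> _; exact: within01_e.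
Qed.

(** On a kept tile [f_base] and [e_base] vanish, and the factor [dens] of the weight is the factor
    in [e_data]. On the other tiles the weight is 1 / Q and the triangle inequality suffices. *)
Lemma fw_le_e N x : 0 <= x < 1 ->
  `|stepf true (f_data N) x| * stepf true (w_data N) x <=
  stepf true (e_data N) x.
Proof.
elim: N x => [|N IH] x x01.
  by rewrite /stepf !big_nil normr0 mul0r.
have [i iH xi] := in_tile_exists Hn_gt0 x01.
rewrite (stepf_f_tile _ xi) (stepf_e_tile _ xi) (stepf_w_tile _ iH xi) //.
case: ifP => iK.
  rewrite !(base_tile_eq0 _ _ _ iK xi) !add0r mulrCA ler_wpM2l //.
  by apply: IH; rewrite -in_tileE.
rewrite !addr0 /stepf !big_cons !big_nil /= !addr0.
rewrite (le_trans (ler_wpM2r _ (ler_normD _ _))) ?invr_ge0 ?(ltW Q_gt0) //.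
rewrite !normrM !normr_nat normrN normr_nat mulrDl.
by rewrite (mulrAC 4) (mulrAC H%:R).
Qed.

(** Each of the two pieces of [e_base] has mass 1 / Q, and tiling preserves the mass of the earlier
    generations by [dens_size]. *)
Lemma mass_e_total N : mass (e_data N) 0 1 = N%:R * 2 / Q.
Proof.
elim: N => [|N IH]; first by rewrite /mass big_nil !mul0r.
have [h1 h2] := Hinv.
rewrite mass_tiled // [X in X + _](_ : _ = 2 / Q); last first.
  rewrite /mass big_cons big_seq1 /= !overlap_full //; [|lra..].
  by rewrite [_ + H%:R^-1]addrC addrK; field; rewrite !gt_eqF.
rewrite (eq_big_seq (fun=> dens / H%:R * mass (e_data N) 0 1)); last first.
  move=> k kK; congr (_ * _); apply: mass_total; first exact: within01_e.
    by rewrite mul0r sub0r oppr_le0.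
  by rewrite mul1r lerBrDl natr1 ler_nat tiles_ltH.
rewrite big_const_seq count_predT iter_addr_0 -(mulr_natr (dens / _ * _)).
by rewrite (mulrAC (dens / _)) dens_size mul1r IH -natr1; field; rewrite gt_eqF.
Qed.

Lemma good_le_w c N s x : 0 <= x < 1 ->
  stepf c (good_data N s) x <= stepf true (w_data N) x.
Proof.
elim: N s x => [|N IH] s x x01.
  rewrite /=; case: ifP => _; rewrite /stepf ?big_nil !big_seq1 /= !inpieceE x01 mul1r //.
  by rewrite mul1r; case: (_ && _).
have [i iH xi] := in_tile_exists Hn_gt0 x01.
rewrite (stepf_w_tile _ iH xi) //= (stepf_tiled_tile _ _ _ _ _ _ xi) ?tiles_uniq //;
  last by move=> k; exact: within01_good.
rewrite {1}/stepf big_nil add0r; case: ifP => // _; last by case/andP: Qinv => /ltW.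
by rewrite ler_wpM2l // IH // -in_tileE.
Qed.

(* Exponential Chebyshev inequality, with exponent 1 / H so that gain k / H is
   at most 1 on the kept tiles. *)
Lemma mass_good_ge N s :
  1 - mass (good_data N s) 0 1 <=
  expR (s / H%:R - N%:R * (L - 2)%:R / (8 * H%:R)).
Proof.
elim: N s => [|N IH] s.
  rewrite !mul0r subr0 /=; case: ltP => s0.
    by rewrite /mass big_seq1 /= overlap_full // subr0 mulr1 subrr expR_ge0.
  rewrite /mass big_nil subr0 (le_trans _ (expR_ge1Dx _)) // lerDl divr_ge0 //.
have M0 := size_tiles_gt0.
(* The missing mass is the average over the kept tiles of the missing masses one generation down,
   each with its threshold lowered by the gain of its tile. *)
have -> : 1 - mass (good_data N.+1 s) 0 1 = (size K)%:R^-1 *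
    \sum_(k <- K) (1 - mass (good_data N (s - gain L k)) 0 1).
  rewrite mass_tiled // /mass big_nil add0r -/(mass _ _ _).
  rewrite (eq_big_seq (fun k => (size K)%:R^-1 *
      mass (good_data N (s - gain L k)) 0 1)); last first.
    move=> k kK; congr (_ * _).
      by rewrite /dens; field; rewrite !gt_eqF.
    apply: mass_total; first exact: within01_good.
      by rewrite mul0r sub0r oppr_le0.
    by rewrite mul1r lerBrDl natr1 ler_nat tiles_ltH.
  rewrite -mulr_sumr sumrB mulrBr; congr (_ - _).
  by rewrite big_const_seq count_predT iter_addr_0 mulVf // gt_eqF.
set E := expR (s / H%:R - N%:R * (L - 2)%:R / (8 * H%:R)).
have step k : k \in K -> 1 - mass (good_data N (s - gain L k)) 0 1 <=
    E * (1 - gain L k / H%:R / 2).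
  move=> kK; apply: (le_trans (IH _)).
  rewrite mulrBl addrAC expRD -/E; apply: ler_wpM2l; first exact: expR_ge0.
  have g0 := @gain_ge0 L R k.
  have gH : gain L k <= H%:R :> R by rewrite gain_le // -mem_tiles.
  set y := gain L k / H%:R; have y0 : 0 <= y by rewrite divr_ge0.
  have y1 : y <= 1 by rewrite ler_pdivrMr // mul1r.
  (* With 0 <= y <= 1: e^-y <= 1 / (1 + y) <= 1 - y / 2. *)
  rewrite expRN; apply: (@le_trans _ _ (1 + y)^-1).
    by rewrite lef_pV2 ?posrE ?expR_gt0 ?expR_ge1Dx //; lra.
  rewrite -[leLHS]mul1r ler_pdivrMr; last lra.
  by nra.
apply: (@le_trans _ _ ((size K)%:R^-1 * \sum_(k <- K) (E * (1 - gain L k / H%:R / 2)))).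
  apply: ler_wpM2l; first by rewrite invr_ge0 ltW.
  rewrite big_seq [leRHS]big_seq.
  by apply: ler_sum => k; exact: step.
rewrite -mulr_sumr sumrB -2!mulr_suml big_const_seq count_predT iter_addr_0.
have -> : s / H%:R - N.+1%:R * (L - 2)%:R / (8 * H%:R) =
    s / H%:R - N%:R * (L - 2)%:R / (8 * H%:R) + - ((L - 2)%:R / (8 * H%:R)).
  by rewrite -natr1; field; rewrite gt_eqF.
rewrite mulrCA expRD -/E ler_wpM2l ?expR_ge0 //.
(* As there are at most H kept tiles, the mean gain is at least (L - 2) / 4. The averaged factor is
   then at most 1 - t <= e^-t with t = (L - 2) / (8 H). *)
have sg := @sum_gain L L_gt2 R; have MH : (size K)%:R <= H%:R :> R.
  by rewrite ler_nat size_tiles_le.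
apply: le_trans (expR_ge1Dx _).
rewrite mulrBr mulVf ?gt_eqF // lerD2l lerN2.
rewrite ler_pdivlMl //.
move: sg; set S := \sum_(k <- K) _; set l := (L - 2)%:R => sg.
have l0 : 0 <= l :> R by [].
have -> : S / H%:R / 2 = (S / H%:R) / 2 by [].
have : l / 4 <= S / H%:R by rewrite ler_pdivlMr.
have : (size K)%:R * (l / (8 * H%:R)) <= l / 8.
  rewrite mulrA ler_pdivrMr ?mulr_gt0 //.
  by rewrite [leRHS](_ : _ = H%:R * l) ?ler_wpM2r //; field.
lra.
Qed.

(** An induction principle common to both transforms: [Psi N s x] will say that the transform of
    generation [N] exceeds [s] at [x]. The flag [c] is [true] for the martingale transform, and
    [false] for the Hilbert transform, where the endpoints of the pieces must be avoided. *)
Lemma good_level (c : bool) (Psi : nat -> R -> R -> Prop) N s x :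
  (forall s x, s < 0 -> inpiece c 0 1 x -> Psi 0%N s x) ->
  (forall N i s x, i \in K -> inpiece c 0 1 (x * H%:R - i%:R) ->
    Psi N (s - gain L i) (x * H%:R - i%:R) -> Psi N.+1 s x) ->
  stepf c (good_data N s) x != 0 -> inpiece c 0 1 x /\ Psi N s x.
Proof.
move=> Psi0 PsiS; elim: N s x => [|N IH] s x.
  rewrite /=; case: ltP => s0; rewrite /stepf ?big_nil ?eqxx // big_seq1 /= mul1r.
  case: (boolP (inpiece _ _ _ _)) => [x01 _|]; last by rewrite eqxx.
  by split=> //; exact: Psi0.
have [x01|] := boolP (0 <= x < 1); last first.
  rewrite negb_and -ltNge -leNgt => hx; rewrite stepf_out ?eqxx //.
  exact: within01_good.
have [i iH xi] := in_tile_exists Hn_gt0 x01.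
rewrite /= (stepf_tiled_tile _ _ _ _ _ _ xi) ?tiles_uniq //;
  last by move=> k; exact: within01_good.
rewrite {1}/stepf big_nil add0r; case: ifP => iK; last by rewrite eqxx.
rewrite mulf_eq0 negb_or => /andP[_] /IH[h1 h2]; split; last exact: PsiS h2.
have [h3 h4] := tile_bounds iK xi; have [h5 _] := Hinv.
rewrite inpieceE (_ : x < 1) ?andbT; last lra.
by case: (c); lra.
Qed.

(** * Lower bounds for the principal value on the kept tiles *)

Lemma shell_bounds j k x : (2 <= j < L)%N -> in_shell L j k -> in_tile H k x ->
  2^-1 + (4 ^+ j)^-1 / 2 <= x /\ x < 2^-1 + (4 ^+ j)^-1.
Proof.
move=> jL jk /andP[]; rewrite ler_pdivrMr // ltr_pdivlMr // => kx xk.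
have e := congr1 (fun n => n%:R : R) (half_H L_gt2).
have [_ jL'] := andP jL.
have e2 := congr1 (fun n => n%:R : R) (shell_widthE L_gt2 jL').
move: jk => /andP[]; move: e2; set w := shell_width L j => e2.
rewrite -(ler_nat R) -(ltr_nat R).
have ej : (4 ^ j)%:R^-1 * H%:R = 2 * w%:R :> R.
  by rewrite -e2 /= !natrM; field; rewrite pnatr_eq0 -lt0n expn_gt0.
have eh : 2^-1 * H%:R = 2 * (4 ^ L.-1)%:R :> R.
  by rewrite -[in LHS]e /= !natrM; field.
rewrite natrD natrM => h1 h2; rewrite -natrX.
move: ej; set a := (4 ^ j)%:R^-1 => ej.
split.
- rewrite -(ler_pM2r H_gt0) mulrDl eh mulrAC ej (le_trans _ kx) //.
  by apply: le_trans h1; lra.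
- rewrite -(ltr_pM2r H_gt0) mulrDl eh ej.
  move: h2; rewrite ltr_nat -(ler_nat R) natrD !natrM => h2.
  by apply: lt_le_trans xk _; lra.
Qed.


(** [ln_ratio_bounds] replaces the positive piece by a unit mass at its left end 1/2 and the
    negative one by a unit mass at its right end 1/4. The hypothesis says that [x] is to the left of
    0 or to the right of the positive piece. *)
Lemma pv_base_ge x : 0 < x * (x - 2^-1 - H%:R^-1) ->
  (x - 2^-1)^-1 - (x - 4^-1)^-1 <= pv f_base x.
Proof.
have [h1 h2] := Hinv; move=> hx.
have {}hx : x < 0 \/ 2^-1 + H%:R^-1 < x.
  have [x0|x0] := ltP x 0; [by left|right].
  have {}x0 : 0 < x.
    by rewrite lt_neqAle x0 andbT eq_sym; apply: contraTneq hx => ->; rewrite mul0r ltxx.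
  by move: hx; rewrite pmulr_rgt0 //; lra.
rewrite /pv big_cons big_seq1 /=.
have /andP[_ k1] : (4^-1 - 0) / (x - 0) <= ln (`|x - 0| / `|x - 4^-1|) <=
    (4^-1 - 0) / (x - 4^-1).
  apply: ln_ratio_bounds; case: hx => hx; [|by apply: mulr_gt0; lra].
  by rewrite -mulrNN mulr_gt0; lra.
have /andP[k2 _] : (2^-1 + H%:R^-1 - 2^-1) / (x - 2^-1) <=
    ln (`|x - 2^-1| / `|x - (2^-1 + H%:R^-1)|) <=
    (2^-1 + H%:R^-1 - 2^-1) / (x - (2^-1 + H%:R^-1)).
  apply: ln_ratio_bounds; case: hx => hx; [|by apply: mulr_gt0; lra].
  by rewrite -mulrNN mulr_gt0; lra.
rewrite addrC; apply: lerD; last first.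
  apply: le_trans (ler_wpM2l (ltW H_gt0) k2).
  by rewrite [2^-1 + _]addrC addrK mulrA mulfV ?mul1r // gt_eqF.
rewrite mulNr lerN2; apply: (le_trans (ler_wpM2l _ k1)) => //.
by rewrite subr0 mulrA mulfV ?mul1r.
Qed.

Lemma pv_base_ge0 x : (x < 0) || (1 < x) -> 0 <= pv f_base x.
Proof.
have [h1 h2] := Hinv; move=> hx; apply: le_trans (pv_base_ge _).
  rewrite subr_ge0; case/orP: hx => hx.
    rewrite -[_^-1]opprK -[leRHS]opprK lerN2 -!invrN lef_pV2 ?posrE; lra.
  rewrite lef_pV2 ?posrE; lra.
by case/orP: hx => hx; [rewrite -mulrNN mulr_gt0 | rewrite mulr_gt0]; lra.
Qed.

(** A point outside of [0, 1] is outside of every tile, so the sign of the base part propagates to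
    all generations. *)
Lemma pv_f_ge0 N x : (x < 0) || (1 < x) -> 0 <= pv (f_data N) x.
Proof.
elim: N x => [|N IH] x hx; first by rewrite /pv big_nil.
rewrite pv_tiled // addr_ge0 ?pv_base_ge0 // big_seq.
apply: sumr_ge0 => k kK; apply: IH; have kH := tiles_ltH kK.
case/orP: hx => hx; apply/orP; [left|right].
  by rewrite subr_lt0 (@lt_le_trans _ _ 0) // pmulr_llt0.
rewrite ltrBrDl natr1 (@le_lt_trans _ _ H%:R) ?ler_nat //.
by rewrite ltr_pMl.
Qed.

(** The tiles other than [i] contribute nonnegatively by [pv_f_ge0], tile [i] contributes the
    rescaled transform, and the base contributes the gain. *)
Lemma pv_f_step N i x : i \in K -> inpiece false 0 1 (x * H%:R - i%:R) ->
  gain L i + pv (f_data N) (x * H%:R - i%:R) <= pv (f_data N.+1) x.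
Proof.
move=> iK; rewrite inpieceE => /andP[y0 y1].
have [h1 h2] := Hinv.
have xi : in_tile H i x by rewrite in_tileE // (ltW y0).
rewrite pv_tiled // (bigD1_seq i) ?tiles_uniq //= addrA.
rewrite -[leLHS]addr0; apply: lerD; last first.
  apply: sumr_ge0 => k ki; apply: pv_f_ge0.
  rewrite subr_lt0 ltrBrDl; move: ki; rewrite neq_ltn => /orP[ki|ik].
    apply/orP; right; rewrite natr1; move: y0; rewrite subr_gt0.
    by apply: le_lt_trans; rewrite ler_nat.
  apply/orP; left; move: y1; rewrite ltrBlDl natr1 => /lt_le_trans; apply.
  by rewrite ler_nat.
rewrite lerD2r; have [b1 b2] := tile_bounds iK xi.
apply: le_trans (pv_base_ge _); last by rewrite mulr_gt0; lra.
have [j jL ij] := is_tileP _ _ (etrans (esym (mem_tiles L_gt2 i)) iK).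
rewrite (gainE L_gt2 jL ij); have [_ s2] := shell_bounds jL ij xi.
(* The base contributes at least 4^j - 4, and 4^j >= 16 turns this into the gain 4^j / 2. *)
have j16 : 16 <= (4 : R) ^+ j.
  rewrite (_ : 16 = 4 ^+ 2); last by rewrite -natrX.
  by rewrite ler_weXn2l //; [lra | case/andP: jL].
have k1 : 4 ^+ j <= (x - 2^-1)^-1.
  by rewrite -[4 ^+ j]invrK lef_pV2 ?posrE ?invr_gt0; lra.
have k2 : (x - 4^-1)^-1 <= 4.
  by rewrite -[4]invrK lef_pV2 ?posrE ?invr_gt0; lra.
lra.
Qed.

Lemma f_mean0 N p q : p <= 0 -> 1 <= q -> mass (f_data N) p q = 0.
Proof.
move=> p0 q1; rewrite (mass_total (@within01_f N)) // => {p0 q1 p q}.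
have [h1 h2] := Hinv.
elim: N => [|N IH]; first by rewrite /mass big_nil.
rewrite mass_tiled // [X in X + _](_ : _ = 0) ?add0r; last first.
  rewrite /mass big_cons big_seq1 /= !overlap_full //; [|lra..].
  by rewrite [_ + H%:R^-1]addrC addrK; field; rewrite !gt_eqF.
rewrite big_seq big1 // => k kK; rewrite (mass_total (@within01_f N)) ?IH ?mulr0 //.
by rewrite mul1r lerBrDl natr1 ler_nat tiles_ltH.
Qed.


Lemma nonempty_pieces_f N : nonempty_pieces (f_data N).
Proof.
have [h1 h2] := Hinv.
elim: N => [//|N IH] t /mem_tiled[|[k [u [kK uF ->]]]] /=.
  by rewrite !inE => /orP[/eqP ->|/eqP ->] /=; lra.
by rewrite ltr_pM2r ?invr_gt0 // ltrD2l; exact: IH.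
Qed.

(** The endpoints of [f_base] lie to the left of all kept tiles, and those coming from another tile
    cannot lie in the interior of tile [i]. *)
Lemma endpoints_f_step N i x : i \in K -> inpiece false 0 1 (x * H%:R - i%:R) ->
  x * H%:R - i%:R \notin endpoints (f_data N) ->
  x \notin endpoints (f_data N.+1).
Proof.
have [h1 h2] := Hinv.
move=> iK; rewrite inpieceE => /andP[y0 y1]; apply: contra.
have xi : in_tile H i x by rewrite in_tileE // (ltW y0).
have [b1 b2] := tile_bounds iK xi.
have key k u v : k \in K -> u \in f_data N -> v = u.1.2 \/ v = u.2 ->
    x = (k%:R + v) / H%:R -> x * H%:R - i%:R \in endpoints (f_data N).
  move=> kK uF uv xE.
  have [w1 w2 w3] := within01_f uF.
  have v01 : 0 <= v <= 1.
    by case: uv => ->; rewrite ?w1 ?w3 ?(le_trans w1 w2) ?(le_trans w2 w3).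
  have e : x * H%:R - i%:R = k%:R - i%:R + v.
    by rewrite xE divfK ?gt_eqF //; ring.
  have ki : k = i.
    apply/eqP; apply: contraT; rewrite neq_ltn -!(ltr_nat R) => ki.
    move: y0 y1; rewrite e; case/orP: ki => ki.
      have : k%:R + 1 <= i%:R :> R by rewrite natr1 ler_nat -(ltr_nat R).
      lra.
    have : i%:R + 1 <= k%:R :> R by rewrite natr1 ler_nat -(ltr_nat R).
    lra.
  rewrite e ki subrr add0r mem_cat; apply/orP.
  by case: uv => ->; [left|right]; apply/mapP; exists u.
rewrite {1}/endpoints mem_cat => /orP[] /mapP[t] /mem_tiled[]; last first.
- by move=> [k [u [kK uF ->]]] /=; apply: key uF _ => //; right.
- by rewrite !inE => /orP[/eqP ->|/eqP ->] /= xE; exfalso; lra.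
- by move=> [k [u [kK uF ->]]] /=; apply: key uF _ => //; left.
- by rewrite !inE => /orP[/eqP ->|/eqP ->] /= xE; exfalso; lra.
Qed.


(* -1 on the intervals [1/2, 1/2 + 4^-j) of each tile of each generation: Haar
   intervals of length 2^-n, where n = 2 j modulo 2 L. *)
Definition tree_sign n k : R :=
  let r := (n %% (2 * L))%N in
  if [&& ~~ odd r, (4 <= r)%N & (k %% 2 ^ r == 2 ^ r.-1)%N] then -1 else 0.

(** * Haar layers of f and the signs adapted to the tiles *)

Lemma H_expn2 : H = (2 ^ (2 * L))%N.
Proof. by rewrite expnM. Qed.

Lemma mass_f_base_out p q : 2^-1 + H%:R^-1 <= p -> mass f_base p q = 0.
Proof.
move=> hp; have [h1 h2] := Hinv.
rewrite /mass big_cons big_seq1 /= !overlap_eq0 ?mulr0 ?addr0 ?hp //.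
by rewrite (_ : 4^-1 <= p) //; lra.
Qed.

Lemma mass_f_tile N i p q : i \in K -> i%:R / H%:R <= p -> q <= i.+1%:R / H%:R ->
  mass (f_data N.+1) p q =
  mass (f_data N) (p * H%:R - i%:R) (q * H%:R - i%:R) / H%:R.
Proof.
move=> iK ip qi; rewrite (@mass_tiled_tile _ _ _ _ _ _ _ _ i) ?tiles_uniq //;
  last by move=> _; exact: within01_f.
rewrite iK mass_f_base_out ?add0r 1?mulrC ?mul1r //.
have [|h1 _] := @tile_bounds i (i%:R / H%:R) iK.
  by rewrite /in_tile lexx /= ltr_pM2r ?invr_gt0 // ltr_nat ltnSn.
by have [h2 h3] := Hinv; lra.
Qed.

(** A tile is a dyadic interval of generation [2 * L], the period of the signs in [n]; and
    [i * 2 ^ n] disappears modulo [2 ^ r] because [r <= n]. *)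
Lemma tree_sign_tile n i k : tree_sign (2 * L + n) (i * 2 ^ n + k) = tree_sign n k.
Proof.
rewrite /tree_sign modnDl; set r := (n %% _)%N.
have -> : ((i * 2 ^ n + k) %% 2 ^ r = k %% 2 ^ r)%N; last by [].
have /subnK <- : (r <= n)%N by exact: leq_mod.
by rewrite expnD mulnA modnMDl.
Qed.

Lemma dpt_tile n i k :
  dpt (2 * L + n) (i * 2 ^ n + k) * H%:R - i%:R = dpt n k :> R.
Proof.
rewrite /dpt expnD -H_expn2 natrD !natrM; field.
by rewrite !pnatr_eq0 -!lt0n !expn_gt0.
Qed.

(** Haar intervals inside tile [i] see only the copy in that tile. The jump is divided by H in the
    passage to the tile, and the factor [2 ^ (2 * L + n)] of the layer compensates for this. *)
Lemma layer_tile N n i x : i \in K -> in_tile H i x ->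
  layer tree_sign (f_data N.+1) (2 * L + n) x =
  layer tree_sign (f_data N) n (x * H%:R - i%:R).
Proof.
move=> iK xi; set y := x * H%:R - i%:R.
have y01 : 0 <= y < 1 by rewrite -in_tileE.
have [k kn yk] := @in_tile_exists _ (2 ^ n) (expn_gt0 2 n) _ y01.
have n0 : 0 < (2 ^ n)%:R :> R by rewrite ltr0n expn_gt0.
have iH := tiles_ltH iK.
have cut m a b : (dpt (2 * L + m) (i * 2 ^ m + a) <= x) = (dpt m a <= y) /\
    (x < dpt (2 * L + m) (i * 2 ^ m + b)) = (y < dpt m b).
  rewrite -!(dpt_tile m i); split.
    by rewrite /y lerD2r ler_pM2r.
  by rewrite /y ltrD2r ltr_pM2r.
have dbl : ((i * 2 ^ n + k).*2 = i * 2 ^ n.+1 + k.*2)%N.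
  by rewrite doubleD doubleMr expnS mul2n.
rewrite (layer_single _ _ kn yk) (@layer_single _ _ _ _ (i * 2 ^ n + k)).
- rewrite tree_sign_tile.
  have -> : side (2 * L + n) (i * 2 ^ n + k) x = side n k y.
    rewrite /side !inpieceE dbl -!addnS.
    by rewrite !(cut n.+1 _ 0%N).1 !(cut n.+1 0%N _).2.
  have -> : jump (f_data N.+1) (2 * L + n) (i * 2 ^ n + k) =
      jump (f_data N) n k / H%:R.
    have lo : i%:R / H%:R = dpt (2 * L + n).+1 (i * 2 ^ n.+1) :> R.
      rewrite /dpt -addnS expnD -H_expn2 !natrM; field.
      by rewrite !pnatr_eq0 -!lt0n !expn_gt0.
    have hi : i.+1%:R / H%:R = dpt (2 * L + n).+1 (i.+1 * 2 ^ n.+1) :> R.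
      rewrite /dpt -addnS expnD -H_expn2 !natrM; field.
      by rewrite !pnatr_eq0 -!lt0n !expn_gt0.
    have p0 : 0 < (2 ^ (2 * L + n).+1)%:R^-1 :> R.
      by rewrite invr_gt0 ltr0n expn_gt0.
    have kn' : (k.*2.+2 <= 2 ^ n.+1)%N by rewrite expnS mul2n -doubleS leq_double.
    have lok a : i%:R / H%:R <= dpt (2 * L + n.+1) (i * 2 ^ n.+1 + a) :> R.
      by rewrite addnS lo ler_pM2r // ler_nat leq_addr.
    have hik a : (a <= 2 ^ n.+1)%N ->
        dpt (2 * L + n.+1) (i * 2 ^ n.+1 + a) <= i.+1%:R / H%:R :> R.
      by move=> ha; rewrite addnS hi ler_pM2r // ler_nat mulSn addnC leq_add2r.
    rewrite /jump dbl -!addnS.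
    rewrite !(@mass_f_tile N i) ?lok ?hik ?(ltnW kn') // !dpt_tile.
    by rewrite mulrBl.
  rewrite expnD -H_expn2 natrM; field; exact/lt0r_neq0.
- rewrite expnD -H_expn2.
  by apply: (@leq_trans (i.+1 * 2 ^ n)); [rewrite mulSn addnC ltn_add2r |
    rewrite leq_mul2r iH orbT].
- rewrite /in_tile -/(dpt _ _) -/(dpt _ (_.+1)) -addnS.
  by rewrite (cut n _ 0%N).1 (cut n 0%N _).2.
Qed.


(** An interval with endpoints on the grid contains or misses each tile, and the copy in a tile that
    it contains has integral zero by [f_mean0]. *)
Lemma mass_f_grid N a b : mass (f_data N.+1) (a%:R / H%:R) (b%:R / H%:R) =
  mass f_base (a%:R / H%:R) (b%:R / H%:R).
Proof.
rewrite mass_tiled // big1 ?addr0 // => k _; rewrite !divfK ?gt_eqF //.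
have [ak|ka] := leqP a k; last first.
  rewrite mass_out ?mulr0 //; first exact: within01_f.
  by rewrite lerBrDl natr1 ler_nat ka orbT.
have [bk|kb] := leqP b k.
  rewrite mass_out ?mulr0 //; first exact: within01_f.
  by rewrite subr_le0 ler_nat bk.
by rewrite f_mean0 ?mulr0 // ?subr_le0 ?ler_nat // lerBrDl natr1 ler_nat.
Qed.

Lemma shell_width_ratio j : (j < L)%N ->
  (shell_width L j)%:R / H%:R = (4 ^+ j)^-1 / 2 :> R.
Proof.
move=> jL; have := congr1 (fun n => n%:R : R) (shell_widthE L_gt2 jL).
move: (shell_width_ge2 L j); move: (shell_width L j) => w w2.
rewrite !natrM -natrX => <-.
by field; rewrite !pnatr_eq0 -!lt0n expn_gt0 (ltnW w2).
Qed.

Lemma half_ratio : (2 * 4 ^ L.-1)%:R / H%:R = 2^-1 :> R.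
Proof.
rewrite -[in X in _ / X](half_H L_gt2) !natrM; field.
by rewrite pnatr_eq0 -lt0n expn_gt0.
Qed.

Section even_layer.
Variable j : nat.
Hypothesis jL : (2 <= j < L)%N.
(** Index of the dyadic interval [1/2, 1/2 + 4^-j), whose right half is shell [j]. *)
Let k0 := (2 ^ (2 * j).-1)%N.

Let j_ltL : (j < L)%N. Proof. by case/andP: jL. Qed.

Let k0_double : (k0.*2 = 2 ^ (2 * j))%N.
Proof. by rewrite -mul2n -expnS prednK // muln_gt0 /= (ltn_trans _ (proj1 (andP jL))). Qed.

Let k0_lt : (k0 < 2 ^ (2 * j))%N.
Proof. by rewrite -k0_double -addnn -[X in (X < _)%N]addn0 ltn_add2l expn_gt0. Qed.

Lemma dpt_shell (c : nat) : dpt (2 * j).+1 (k0.*2 + c) =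
  2^-1 + c%:R * ((4 ^+ j)^-1 / 2) :> R.
Proof.
rewrite /dpt k0_double expnS natrM natrD expnM natrX.
by field; rewrite expf_neq0.
Qed.

(** The halves have grid endpoints, so only [f_base] counts. Its positive unit mass lies in the left
    half, which is at least two tiles wide, and the right half carries none of it. *)
Lemma jump_shell N : jump (f_data N.+1) (2 * j) k0 = 1.
Proof.
have [h1 h2] := Hinv.
have w2 := shell_width_ge2 L j.
have E (c : nat) : dpt (2 * j).+1 (k0.*2 + c) =
    (2 * 4 ^ L.-1 + c * shell_width L j)%:R / H%:R :> R.
  by rewrite dpt_shell natrD mulrDl half_ratio natrM -mulrA shell_width_ratio.
have m : 2^-1 + H%:R^-1 <= dpt (2 * j).+1 (k0.*2 + 1) :> R.
  rewrite E natrD mulrDl half_ratio lerD2l mul1n -[leLHS]mul1r ler_pM2r ?invr_gt0 //.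
  by rewrite ler1n (leq_trans _ w2).
rewrite /jump -[k0.*2.+2]addn2 -[k0.*2.+1]addn1 -[X in dpt _ X](addn0 k0.*2).
have out : mass (f_data N.+1) (dpt (2 * j).+1 (k0.*2 + 1)) (dpt (2 * j).+1 (k0.*2 + 2)) = 0.
  by rewrite 2!{1}E mass_f_grid -!E mass_f_base_out.
rewrite out subr0 2!{1}E mass_f_grid -!E.
have d0 : dpt (2 * j).+1 (k0.*2 + 0) = 2^-1 :> R by rewrite dpt_shell mul0r addr0.
rewrite /mass big_cons big_seq1 /= d0 overlap_eq0; last by rewrite (_ : 4^-1 <= 2^-1) //; lra.
rewrite mulr0 add0r overlap_full //; last lra.
by rewrite [2^-1 + _]addrC addrK mulfV // gt_eqF.
Qed.

Lemma layer_shell N x : layer tree_sign (f_data N.+1) (2 * j) x =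
  - 4 ^+ j * side (2 * j) k0 x.
Proof.
have r : ((2 * j) %% (2 * L) = 2 * j)%N by rewrite modn_small // ltn_mul2l.
rewrite (@layer_single_eps _ _ _ _ k0).
- rewrite jump_shell mulr1 /tree_sign r modn_small // eqxx andbT oddM /=.
  by rewrite (leq_mul2l 2 2 j) (proj1 (andP jL)) expnM natrX mulN1r.
- by [].
- move=> i iN ik; rewrite /tree_sign r modn_small // (negbTE ik).
  by rewrite !andbF.
Qed.

Lemma side_shell x : side (2 * j) k0 x =
  ((2^-1 <= x < 2^-1 + (4 ^+ j)^-1 / 2)%R)%:R -
  ((2^-1 + (4 ^+ j)^-1 / 2 <= x < 2^-1 + (4 ^+ j)^-1)%R)%:R.
Proof.
rewrite /side !inpieceE -[k0.*2.+2]addn2 -[k0.*2.+1]addn1.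
rewrite -[X in dpt _ X <= _](addn0 k0.*2) !dpt_shell mul0r addr0 mul1r.
by rewrite [2 * _]mulrC divfK.
Qed.

End even_layer.

Lemma layer_odd N n x : (n < 2 * L)%N -> odd n || (n < 4)%N ->
  layer tree_sign (f_data N) n x = 0.
Proof.
move=> nL hn; rewrite /layer big1 // => k _; rewrite /tree_sign modn_small //.
by rewrite leqNgt; case/orP: hn => ->; rewrite ?andbF /= !mul0r.
Qed.

Lemma sum_layers N x : \sum_(0 <= n < 2 * L) layer tree_sign (f_data N.+1) n x =
  \sum_(2 <= j < L) - 4 ^+ j * side (2 * j) (2 ^ (2 * j).-1) x.
Proof.
have E m : (2 <= m <= L)%N ->
    \sum_(0 <= n < 2 * m) layer tree_sign (f_data N.+1) n x =
    \sum_(2 <= j < m) - 4 ^+ j * side (2 * j) (2 ^ (2 * j).-1) x.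
  elim: m => // m IH /andP[m1 mL].
  (* The induction really starts at 2: the generations below 4 carry no sign. *)
  have [->|m2] := eqVneq m 1%N.
    rewrite [RHS]big_geq // big_nat_cond big1 // => n /andP[/andP[_ n4] _].
    by rewrite layer_odd ?n4 ?orbT // (leq_trans n4) // leq_mul2l ltnW.
  have m2' : (2 <= m)%N by case: m m1 m2 {IH mL} => [|[|]].
  rewrite [RHS]big_nat_recr //= -IH; last by rewrite m2' ltnW.
  rewrite mulnS addnC addn2 !big_nat_recr //= -addrA; congr (_ + _).
  rewrite -/(f_data N.+1) layer_shell ?m2' // layer_odd ?addr0 /= ?oddM //.
  by rewrite (leq_trans _ (leq_mul (leqnn 2) mL)) // mulnS addnC addn2.
by apply: E; rewrite leqnn ltnW.
Qed.

(** A point of shell J lies in the left half of the intervals with j < J, which contribute -4^j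
    each, in the right half of the one with j = J, which contributes 4^J, and outside of the later
    ones. *)
Lemma sum_layers_ge N i x : i \in K -> in_tile H i x ->
  gain L i <= \sum_(0 <= n < 2 * L) layer tree_sign (f_data N.+1) n x.
Proof.
move=> iK xi; rewrite sum_layers.
have [J JL iJ] := is_tileP _ _ (etrans (esym (mem_tiles L_gt2 i)) iK).
have [x1 x2] := shell_bounds JL iJ xi; rewrite (gainE L_gt2 JL iJ).
have [J2 J3] := andP JL.
have p4 j : 0 < (4 ^+ j)^-1 :> R by rewrite invr_gt0 exprn_gt0.
have dec j k : (j < k)%N -> 4 * (4 ^+ k)^-1 <= (4 ^+ j)^-1 :> R.
  move=> jk; rewrite ler_pdivrMr ?exprn_gt0 // ler_pdivlMl ?exprn_gt0 //.
  by rewrite -exprSr ler_weXn2l //; lra.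
have E1 : \sum_(2 <= j < J) - 4 ^+ j * side (2 * j) (2 ^ (2 * j).-1) x =
    \sum_(2 <= j < J) - 4 ^+ j.
  apply: eq_big_nat => j /andP[j2 jJ].
  rewrite side_shell ?j2 ?(ltn_trans jJ) //; have h1 := dec _ _ jJ.
  have h2 := p4 j; have h3 := p4 J.
  have -> : (2^-1 <= x < 2^-1 + (4 ^+ j)^-1 / 2) = true by apply/andP; split; lra.
  have -> : (2^-1 + (4 ^+ j)^-1 / 2 <= x) = false by apply/negbTE; rewrite -ltNge; lra.
  by rewrite subr0 mulr1.
have E2 : \sum_(J.+1 <= j < L) - 4 ^+ j * side (2 * j) (2 ^ (2 * j).-1) x = 0.
  rewrite big_nat_cond big1 // => j /andP[/andP[jJ jL] _].
  rewrite side_shell ?jL ?(leq_trans J2 (ltnW jJ)) //; have h1 := dec _ _ jJ.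
  have h2 := p4 j.
  have -> : (x < 2^-1 + (4 ^+ j)^-1 / 2) = false by apply/negbTE; rewrite -leNgt; lra.
  have -> : (x < 2^-1 + (4 ^+ j)^-1) = false by apply/negbTE; rewrite -leNgt; lra.
  by rewrite !andbF subrr mulr0.
rewrite (big_cat_nat J2 (ltnW J3)) /= [X in _ + X]big_ltn // E1 E2 addr0.
rewrite side_shell //; have h3 := p4 J.
have -> : (x < 2^-1 + (4 ^+ J)^-1 / 2) = false by apply/negbTE; rewrite -leNgt.
rewrite x1 x2 andbF sub0r mulrNN mulr1.
(* The geometric sum of the negative terms takes away at most half of 4^J, which leaves the gain 4^J
   / 2. *)
have geo m : \sum_(2 <= j < m) 4 ^+ j <= 4 ^+ m / 2 :> R.
  elim: m => [|m IHm]; first by rewrite big_geq // divr_ge0 // exprn_ge0.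
  have [m2|m2] := leqP 2 m.
    have m0 : 0 <= (4 : R) ^+ m by rewrite exprn_ge0.
    by rewrite big_nat_recr //= exprS; move: IHm; set u := \sum_(_ <= _ < _) _; lra.
  by rewrite big_geq // divr_ge0 // exprn_ge0.
by rewrite sumrN; have := geo J; set u := \sum_(_ <= _ < _) _; lra.
Qed.

Lemma layers_step N i s x : i \in K -> inpiece true 0 1 (x * H%:R - i%:R) ->
  s - gain L i < \sum_(0 <= n < 2 * L * N)
    layer tree_sign (f_data N) n (x * H%:R - i%:R) ->
  s < \sum_(0 <= n < 2 * L * N.+1) layer tree_sign (f_data N.+1) n x.
Proof.
move=> iK; rewrite inpieceE -in_tileE // => xi hs.
rewrite mulnS (big_cat_nat _ (leq_addr _ _)) //=.
rewrite -{2}[(2 * L)%N]add0n big_addn addKn.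
have := sum_layers_ge N iK xi.
under [X in _ -> _ < _ + X]eq_bigr do rewrite addnC (layer_tile _ _ iK xi).
lra.
Qed.

End construction.

(** * The weight on the line and its two [A_1] norms, with Q = H and H generations *)

Section weight_estimates.
Context {R : realType}.
Variable L : nat.
Hypothesis L_gt2 : (2 < L)%N.
Local Notation mu := (@lebesgue_measure R).
Local Notation Q := ((4 ^ L)%:R : R).
Local Notation W := (w_data L Q (4 ^ L)).
Local Notation f := (stepf true (f_data L (4 ^ L)) : R -> R).
Implicit Types (x p q : R).

(* The first piece makes the weight equal to 1/Q outside of [0, 1). *)
Definition weight x : R := Q^-1 + stepf true ((- Q^-1, 0, 1) :: W) x.

Let Q_ge64 : 64 <= Q. Proof. exact: H_ge64. Qed.
Let Q_ge1 : 1 <= Q. Proof. by rewrite (le_trans _ Q_ge64) // ler1n. Qed.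
Let Q_gt0 : 0 < Q. Proof. exact: lt_le_trans Q_ge1. Qed.
Let Qinv : 0 < Q^-1 <= 1. Proof. by rewrite invr_gt0 Q_gt0 invf_le1. Qed.

Lemma weight_in x : 0 <= x < 1 -> weight x = stepf true W x.
Proof.
move=> x01; rewrite /weight /stepf big_cons /= inpieceE x01 mulr1.
by rewrite addrA subrr add0r.
Qed.

Lemma weight_out x : ~~ (0 <= x < 1) -> weight x = Q^-1.
Proof.
move=> x01; rewrite /weight /stepf big_cons -/(stepf true W x) /= inpieceE.
rewrite (negbTE x01) mulr0 add0r stepf_out ?addr0 //; first exact: within01_w.
by rewrite ltNge [X in _ || X]leNgt -negb_and.
Qed.

Lemma weight_ge x : Q^-1 <= weight x.
Proof.
have [x01|x01] := boolP (0 <= x < 1); last by rewrite weight_out.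
by rewrite weight_in // w_ge.
Qed.

Lemma weight_gt0 x : 0 < weight x.
Proof. by apply: lt_le_trans (weight_ge x); case/andP: Qinv. Qed.

Lemma measurable_weight D : measurable_fun D weight.
Proof. by apply: measurable_funD => //; exact: measurable_stepf. Qed.

Lemma integrable_weight (b0 b1 : bool) p q :
  mu.-integrable [set` Interval (BSide b0 p) (BSide b1 q)] (EFin \o weight).
Proof.
have mI : measurable [set` Interval (BSide b0 p) (BSide b1 q)] by exact: measurable_itv.
have I1 : mu.-integrable [set` Interval (BSide b0 p) (BSide b1 q)] (fun=> (Q^-1)%:E).
  apply/integrableP; split; first exact: measurable_cst.
  rewrite integral_cst //= lebesgue_measure_itv /=.
  by case: ifP => _; rewrite -?EFinB -?EFinM ?mule0 ltry.
have := @integrableD _ _ _ mu _ mI _ _ I1 (integrable_stepf true ((- Q^-1, 0, 1) :: W) mI).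
by [].
Qed.

Lemma integral_weight (b0 b1 : bool) p q : p <= q ->
  (\int[mu]_(x in [set` Interval (BSide b0 p) (BSide b1 q)]) (weight x)%:E =
   (mass W p q + Q^-1 * (q - p - overlap 0 1 p q))%:E)%E.
Proof.
move=> pq.
have mI : measurable [set` Interval (BSide b0 p) (BSide b1 q)] by exact: measurable_itv.
have mp : mu [set` Interval (BSide b0 p) (BSide b1 q)] = (q - p)%:E.
  rewrite lebesgue_measure_itv /= lte_fin; case: ltP => qp.
    by rewrite -EFinB.
  by rewrite (_ : q = p) ?subrr //; apply: le_anti; rewrite pq qp.
have I1 : mu.-integrable [set` Interval (BSide b0 p) (BSide b1 q)] (fun=> (Q^-1)%:E).
  apply/integrableP; split; first exact: measurable_cst.
  by rewrite integral_cst //= mp -EFinM ltry.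
under eq_integral do rewrite /weight EFinD.
rewrite integralD //; last exact: integrable_stepf.
rewrite integral_cst // [X in (_ * X + _)%E]mp integral_stepf_itv -EFinM -EFinD; congr EFin.
by rewrite /mass big_cons /=; ring.
Qed.

(** The part in [0, 1) costs 160, by [mass_w_A1] if [x] is in [0, 1) and otherwise by
    [mass_w_boundary], the interval then leaving (0, 1). The constant part outside costs 1 more. *)
Lemma weight_avg_le (b0 b1 : bool) p q x : p <= x -> x < q ->
  (\int[mu]_(x in [set` Interval (BSide b0 p) (BSide b1 q)]) (weight x)%:E <=
   (161 * Q * weight x * (q - p))%:E)%E.
Proof.
move=> px xq; have pq : p <= q by rewrite (le_trans px) // ltW.
rewrite integral_weight // lee_fin.
have [Q0 Q1] := andP Qinv.
have o0 := overlap_ge0 0 1 p q; have qp : 0 <= q - p by rewrite subr_ge0.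
have QQ : Q * Q^-1 = 1 by rewrite divff // gt_eqF.
have wg := weight_ge x; have w0 := weight_gt0 x.
have Qw : Q^-1 <= Q * weight x.
  by rewrite (le_trans wg) // ler_peMl // ltW.
have h1 : Q^-1 * (q - p - overlap 0 1 p q) <= Q * weight x * (q - p).
  by apply: ler_pM; [exact: ltW | rewrite subr_ge0 overlap_le | | lra].
have h2 : mass W p q <= 160 * Q * weight x * (q - p).
  have [x01|x01] := boolP (0 <= x < 1).
    by rewrite weight_in // mass_w_A1.
  rewrite weight_out // -(mulrA 160) QQ mulr1.
  apply: (@le_trans _ _ (5 * overlap 0 1 p q)).
    apply: mass_w_boundary => //.
    move: x01; rewrite negb_and -ltNge -leNgt => /orP[h|h]; apply/orP; [left|right]; lra.
  by apply: ler_pM; rewrite ?overlap_le //; lra.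
lra.
Qed.

Lemma weight_avg_ge (b0 b1 : bool) p q : p <= 0 -> 1 <= q ->
  (1 <= \int[mu]_(x in [set` Interval (BSide b0 p) (BSide b1 q)]) (weight x)%:E)%E.
Proof.
move=> p0 q1; have pq : p <= q by lra.
rewrite integral_weight // lee_fin.
rewrite (mass_total (@within01_w _ _ _ _)) //.
have [_ m1] := mass_w_bounds L_gt2 Q_ge1 0 1 (lexx Q).
have [Q0 Q1] := andP Qinv.
suff : 0 <= Q^-1 * (q - p - overlap 0 1 p q) by lra.
by apply: mulr_ge0; [exact: ltW | rewrite subr_ge0 overlap_le].
Qed.

Lemma weight_left x : x < 2^-1 -> weight x = Q^-1.
Proof.
move=> x2; have [x01|x01] := boolP (0 <= x < 1); last exact: weight_out.
rewrite weight_in //.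
have [i iH xi] := @in_tile_exists _ (4 ^ L) (expn_gt0 4 L) _ x01.
have [m mE] : exists m, (4 ^ L = m.+1)%N by exists (4 ^ L).-1; rewrite prednK // expn_gt0.
rewrite {2}mE (stepf_w_tile Q L_gt2 m iH xi); case: ifP => // iK.
have [h _] := tile_bounds L_gt2 iK xi.
have [Q0 _] := andP Qinv; lra.
Qed.


Lemma iavg_weight (b0 b1 : bool) p q : p < q ->
  iavg weight [set` Interval (BSide b0 p) (BSide b1 q)] =
  (((q - p)^-1)%:E *
   \int[mu]_(x in [set` Interval (BSide b0 p) (BSide b1 q)]) (weight x)%:E)%E.
Proof.
move=> pq; rewrite /iavg; congr (_ * _)%E.
  rewrite lebesgue_measure_itv /= lte_fin pq -EFinB inver.
  by rewrite subr_eq0 (gt_eqF pq).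
by apply: eq_integral => x _; rewrite /= ger0_norm // ltW // weight_gt0.
Qed.

Lemma iavg_weight_le (b0 b1 : bool) p q x : p <= x -> x < q ->
  (iavg weight [set` Interval (BSide b0 p) (BSide b1 q)] <=
   (161 * Q * weight x)%:E)%E.
Proof.
move=> px xq; have pq : p < q by exact: le_lt_trans xq.
have qp : 0 < q - p by rewrite subr_gt0.
rewrite iavg_weight // (le_trans (lee_pmul _ _ (lexx _) (weight_avg_le b0 b1 px xq))) //.
- by rewrite lee_fin invr_ge0 ltW.
- by apply: integral_ge0 => y _; rewrite lee_fin ltW // weight_gt0.
- by rewrite -EFinM lee_fin mulrCA mulVf ?mulr1 // gt_eqF.
Qed.

Lemma HL_weight_le x : (HL_maximal weight x <= (161 * Q * weight x)%:E)%E.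
Proof.
apply: ge_ereal_sup => _ [r /= r0 <-]; move: r0; rewrite in_itv /= andbT => r0.
by rewrite ball_itv; apply: (@iavg_weight_le _ _ _ _ x); lra.
Qed.

Lemma HL_weight_ge x : 0 <= x < 4^-1 -> (2^-1%:E <= HL_maximal weight x)%E.
Proof.
move=> /andP[x0 x4]; apply: (@le_trans _ _ (iavg weight (ball x 1))); last first.
  by apply: ereal_sup_ubound; exists 1 => //=; rewrite in_itv /= andbT.
have x1 : x - 1 < x + 1 by lra.
rewrite ball_itv iavg_weight //.
have -> : (x + 1 - (x - 1))^-1 = 2^-1 by congr (_^-1); ring.
rewrite -[X in (X <= _)%E]mule1; apply: lee_wpmul2l; first by rewrite lee_fin.
by apply: weight_avg_ge; lra.
Qed.

Lemma positive_measure_not_negligible (P : R -> Prop) a b : a < b ->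
  (forall x, a <= x < b -> ~ P x) -> ~ (\forall x \ae mu, P x).
Proof.
move=> ab nP [N [mN N0 PN]].
have : (mu `[a, b[%classic <= mu N)%E.
  apply: le_measure; rewrite ?inE //.
  by move=> x /=; rewrite in_itv /= => /nP xP; apply: PN.
rewrite N0 lebesgue_measure_itv /= lte_fin ab -EFinB lee_fin.
by apply/negP; rewrite -ltNge subr_gt0.
Qed.

Lemma A1_norm_weight_le : (A1_norm weight <= (161 * Q)%:E)%E.
Proof.
apply/ess_supP; apply: aeW => x /=.
have w0 := weight_gt0 x.
apply: (@le_trans _ _ ((161 * Q * weight x)%:E * ((weight x)^-1)%:E)%E).
  by apply: lee_wpmul2r; [rewrite lee_fin invr_ge0 ltW | exact: HL_weight_le].
by rewrite -EFinM lee_fin mulfK // gt_eqF.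
Qed.

(** On [0, 1/4), a set of positive measure, the weight is 1 / Q, while the interval of radius 1
    around [x] covers [0, 1] and has average at least 1/2. *)
Lemma A1_norm_weight_ge : ((Q / 2)%:E <= A1_norm weight)%E.
Proof.
rewrite leNgt; apply/negP => lt; have := ltW lt.
set y := A1_norm weight in lt * => _.
have := ess_sup_ge mu (fun x => HL_maximal weight x * ((weight x)^-1)%:E)%E.
apply: (@positive_measure_not_negligible _ 0 4^-1); first by rewrite invr_gt0.
move=> x x4; apply/negP; rewrite -ltNge; apply: lt_le_trans lt _.
have [x0 x1] := andP x4.
rewrite weight_left ?invrK; last lra.
rewrite (_ : Q / 2 = 2^-1 * Q) ?EFinM; last by rewrite mulrC.
by apply: lee_wpmul2r; [rewrite lee_fin | exact: HL_weight_ge].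
Qed.

Lemma line_weight_weight : line_weight weight.
Proof.
split; last by apply: aeW => x; exact: weight_gt0.
split; [exact: measurable_weight | exact: openT |].
move=> K _ /compact_bounded [M [_ MK]].
have KM : K `<=` `[- (M + 1), M + 1]%classic.
  move=> x /(MK (M + 1)); rewrite ltrDl ltr01 => /(_ isT) /=.
  by rewrite ler_norml in_itv.
have /integrableP[_] := integrable_weight true false (- (M + 1)) (M + 1).
apply: le_lt_trans; apply: integral_le_nonmeasurable => // x.
rewrite /patch; case: ifPn => xK; case: ifPn => // xM.
  by move/negP: xM; case; apply/mem_set/KM; exact: set_mem.
by rewrite abse_ge0.
Qed.

Lemma unit_weight_weight : unit_weight weight.
Proof.
by split; [exact: integrable_weight | apply: aeW => x _; exact: weight_gt0].
Qed.

Lemma dyadic_A1_weight_le n k : (k < 2 ^ n)%N ->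
  (iavg weight (dyadic n k) <= (161 * Q)%:E * dyadic_ess_inf weight n k)%E.
Proof.
move=> kn; set I := iavg _ _.
have n0 : 0 < (2 ^ n)%:R :> R by rewrite ltr0n expn_gt0.
have ab : dpt n k < dpt n k.+1 :> R by rewrite ltr_pM2r ?invr_gt0 // ltr_nat.
have IE : I \is a fin_num.
  by rewrite /I dyadicE iavg_weight // integral_weight ?ltW // -EFinM.
have C0 : 0 < 161 * Q by rewrite mulr_gt0.
rewrite -(fineK IE) -lee_pdivrMl // -EFinM; apply/ess_infP.
(* The complement of the interval is null for the restricted measure, so the pointwise bound on the
   interval suffices. *)
exists (~` dyadic n k); split.
- by apply: measurableC; exact: measurable_dyadic.
- by change (mu (~` dyadic n k `&` dyadic n k) = 0%E); rewrite setICl measure0.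
move=> x; apply: contra_not => xI /=; rewrite lee_fin ler_pdivrMl //.
rewrite -lee_fin fineK // /I; move: xI; rewrite dyadicE /piece /= in_itv /= => /andP[h1 h2].
exact: iavg_weight_le.
Qed.

(** The top interval already decides: its average is at least 1, and its essential infimum is
    exactly 1 / Q. *)
Lemma dyadic_A1_weight_ge (C : R) :
  (iavg weight (dyadic 0 0) <= C%:E * dyadic_ess_inf weight 0 0)%E -> Q <= C.
Proof.
rewrite dyadicE.
have d0 : dpt 0 0 = 0 :> R by rewrite /dpt mul0r.
have d1 : dpt 0 1 = 1 :> R by rewrite /dpt expn0 divr1.
rewrite d0 d1 iavg_weight // subr0 invr1 mul1e => h.
have {h} : (1 <= C%:E * dyadic_ess_inf weight 0 0)%E.
  by apply: le_trans h; apply: weight_avg_ge.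
have [Q0 Q1] := andP Qinv.
have e0 : (Q^-1%:E <= dyadic_ess_inf weight 0 0)%E.
  by apply/ess_infP; apply: aeW => x; rewrite lee_fin weight_ge.
(* The weight equals 1 / Q on [0, 1/4), so a larger essential infimum would make this interval
   null. *)
have e1 : (dyadic_ess_inf weight 0 0 <= Q^-1%:E)%E.
  rewrite leNgt; apply/negP => lt.
  have [N [mN N0 PN]] := ess_inf_le (mrestr mu (measurable_dyadic 0 0)) (EFin \o weight).
  pose J : set R := `[0, 4^-1[%classic.
  have : (mu J <= mu (N `&` dyadic 0 0))%E.
    apply: le_measure; rewrite ?inE;
      [exact: measurable_itv | by apply: measurableI => //; exact: measurable_dyadic |].
    move=> x; rewrite /J /= in_itv /= => /andP[x0 x4]; split.
      apply: PN => /= le; move: lt; rewrite ltNge => /negP; apply.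
      by rewrite (le_trans le) // lee_fin weight_left //; lra.
    by rewrite dyadicE d0 d1 /piece /= in_itv /= x0; lra.
  rewrite [X in (_ <= X)%E]N0 /J lebesgue_measure_itv /= lte_fin.
  by rewrite invr_gt0 ltr0n /= -EFinB lee_fin subr0; lra.
have -> : dyadic_ess_inf weight 0 0 = Q^-1%:E by apply/eqP; rewrite eq_le e0 e1.
by rewrite -EFinM lee_fin ler_pdivlMr // mul1r.
Qed.

Lemma dyadic_A1_norm_weight : exists C : R,
  [/\ dyadic_A1_norm weight = C%:E, Q <= C & C <= 161 * Q].
Proof.
have up : (dyadic_A1_norm weight <= (161 * Q)%:E)%E.
  apply: ereal_inf_lbound; exists (161 * Q) => //= n k kn.
  exact: dyadic_A1_weight_le.
have low : (Q%:E <= dyadic_A1_norm weight)%E.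
  apply: le_ereal_inf_tmp => _ [C /= hC <-]; rewrite lee_fin.
  by apply: dyadic_A1_weight_ge; apply: hC.
have fn : dyadic_A1_norm weight \is a fin_num.
  by rewrite fin_real // (lt_le_trans _ low) ?ltNyr //= (le_lt_trans up) ?ltry.
exists (fine (dyadic_A1_norm weight)).
by rewrite fineK //; split => //; rewrite -lee_fin fineK.
Qed.


(** * Weak-type lower bounds for both transforms *)

Lemma fw_le x : `|f x| * weight x <= stepf true (e_data L Q (4 ^ L)) x.
Proof.
have [x01|x01] := boolP (0 <= x < 1).
  by rewrite weight_in // fw_le_e.
rewrite [f x]stepf_out ?normr0 ?mul0r; last 2 first.
- exact: within01_f.
- by rewrite ltNge [X in _ || X]leNgt -negb_and.
by apply: stepf_ge0; exact: pos_e.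
Qed.

Lemma weighted_norm_f_le (D : set R) : measurable D ->
  (\int[mu]_(x in D) (`|f x| * weight x)%:E <= 2%:E)%E.
Proof.
move=> mD.
have -> : 2%:E = (\int[mu]_x (stepf true (e_data L Q (4 ^ L)) x)%:E)%E.
  rewrite integral_stepfT; last exact: within01_e.
  by rewrite mass_e_total // mulrAC divff ?mul1r // gt_eqF.
have e0 x : 0 <= stepf true (e_data L Q (4 ^ L)) x.
  by apply: stepf_ge0; exact: pos_e.
apply: integral_le_nonmeasurable => [x _|x _|x].
- by rewrite lee_fin mulr_ge0 // ltW // weight_gt0.
- by rewrite lee_fin.
rewrite patch_setT /patch; case: ifP => _; rewrite lee_fin //.
exact: fw_le.
Qed.

Lemma weighted_L1_f (D : set R) : measurable D -> weighted_L1 D weight f.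
Proof.
move=> mD; split; first exact: measurable_stepf.
exact: le_lt_trans (weighted_norm_f_le mD) (ltry _).
Qed.

(** Half of Q (L - 2) / 8, the threshold at which the exponent in [mass_good_ge] vanishes for Q
    generations. *)
Definition level : R := Q * (L - 2)%:R / 16.

Hypothesis L_ge18 : (18 <= L)%N.

Let L2_ge16 : 16 <= (L - 2)%:R :> R.
Proof. by rewrite ler_nat; move: L_ge18; clear; lia. Qed.

Lemma level_gt0 : 0 < level.
Proof. by have h := L2_ge16; rewrite /level divr_gt0 // mulr_gt0 //; lra. Qed.

(** At this level the exponent is -(L - 2) / 16, hence at most -1 for L >= 18, and e^-1 <= 1/2. *)
Lemma mass_good_half : 2^-1 <= mass (good_data L (4 ^ L) level) 0 1.
Proof.
have := mass_good_ge L_gt2 Q_ge1 (4 ^ L) level.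
have -> : level / Q - Q * (L - 2)%:R / (8 * Q) = - ((L - 2)%:R / 16).
  by rewrite /level; field; rewrite gt_eqF.
rewrite expRN; set E := expR _; have E2 : 2 <= E.
  by apply: le_trans (expR_ge1Dx _); have := L2_ge16; lra.
have : E^-1 <= 2^-1 by rewrite lef_pV2 ?posrE //; lra.
lra.
Qed.

(** The good data minorize the weight on the level set, so the level set has w-mass at least 1/2. As
    f has weighted norm at most 2, the weak-type inequality reads l / 2 <= 2 K. *)
Lemma weak_type_constant_ge (D : set R) (K : \bar R) (Tf : R -> R) c (l : R) :
  measurable D -> 0 < l -> (0 <= K)%E ->
  (forall x, stepf c (good_data L (4 ^ L) level) x != 0 -> D x /\ l < `|Tf x|) ->
  weak_type_bound D weight K f Tf -> ((l / 4)%:E <= K)%E.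
Proof.
move=> mD l0 K0 hgood /(_ l l0) hK.
have half : (2^-1%:E <= weighted_measure weight (D `&` [set x | (l < `|Tf x|)%R]))%E.
  apply: (@le_trans _ _ (\int[mu]_x (stepf c (good_data L (4 ^ L) level) x)%:E)%E).
    rewrite integral_stepfT ?lee_fin ?mass_good_half //; exact: within01_good.
  have g0 x : 0 <= stepf c (good_data L (4 ^ L) level) x.
    by apply: stepf_ge0; exact: (pos_good L_gt2 Q_ge1).
  apply: integral_le_nonmeasurable => [x _|x _|x].
  - by rewrite lee_fin.
  - by rewrite lee_fin ltW // weight_gt0.
  rewrite patch_setT /patch; case: ifPn => xS.
    rewrite lee_fin; have [x01|x01] := boolP (0 <= x < 1).
      by rewrite weight_in // good_le_w.
    rewrite stepf_out ?(ltW (weight_gt0 x)) //; first exact: within01_good.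
    by rewrite ltNge [X in _ || X]leNgt -negb_and.
  rewrite lee_fin; have [->//|gx] := eqVneq (stepf c (good_data L (4 ^ L) level) x) 0.
  by case/negP: xS; apply/mem_set; exact: hgood.
have : (l%:E * 2^-1%:E <= K * 2%:E)%E.
  apply: le_trans (lee_wpmul2l _ half) _; first by rewrite lee_fin ltW.
  apply: le_trans hK _; apply: lee_wpmul2l => //.
  exact: weighted_norm_f_le.
case: K K0 {hK} => [r|_ _|//]; last by rewrite leey.
by rewrite -!EFinM !lee_fin; lra.
Qed.

Lemma hilbert_weak_norm_ge : ((level / 16)%:E <= hilbert_weak_norm weight)%E.
Proof.
apply: le_ereal_inf_tmp => K /= [K0 hK].
have f1 : weighted_L1 setT weight f by exact: weighted_L1_f.
have f2 : hilbert_defined f by apply: hilbert_defined_stepf; exact: nonempty_pieces_f.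
have := @weak_type_constant_ge setT K (hilbert f) false (level / 4) measurableT.
have l0 := level_gt0.
have -> : level / 4 / 4 = level / 16 by field.
apply=> //; [lra | | exact: hK].
(* The predicate also keeps [x] off the endpoints, where [hilbert_stepf] gives no value. The level
   is divided by 4 because the proof uses pi <= 4. *)
move=> x /(@good_level _ _ L_gt2 _ (fun N s x => s < pv (f_data L N) x /\
  x \notin endpoints (f_data L N))).
case=> [s {}x s0 _|N i s {}x iK hx [h1 h2]|_ [h1 h2]].
- by split; rewrite ?/pv ?big_nil.
- split; last exact: (endpoints_f_step L_gt2 iK).
  by have := pv_f_step L_gt2 N iK hx; lra.
split=> //; rewrite hilbert_stepf //; last exact: nonempty_pieces_f.
have pi4 : pi <= 4 :> R by have /andP[_ h] := @pihalf_02 R; lra.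
have p0 : 0 < pi^-1 :> R by rewrite invr_gt0 pi_gt0.
rewrite ger0_norm ?mulr_ge0 ?ltW //; last exact: lt_trans h1.
apply: (@le_lt_trans _ _ (pi^-1 * level)); last by rewrite ltr_pM2l.
rewrite mulrC; apply: ler_wpM2r; first exact: ltW.
by rewrite lef_pV2 ?posrE ?pi_gt0.
Qed.

Lemma martingale_weak_norm_ge : ((level / 16)%:E <= martingale_weak_norm weight)%E.
Proof.
apply: le_ereal_inf_tmp => K /= [K0 hK].
have mU : measurable (unit_itv : set R) by exact: measurable_itv.
have f1 := weighted_L1_f mU.
pose N0 := (2 * L * 4 ^ L)%N.
(* Cutting the signs after the last generation of f makes the series a finite sum. *)
pose eps n k : R := if (n < N0)%N then tree_sign L n k else 0.
have eps1 n k : -1 <= eps n k <= 1.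
  by rewrite /eps /tree_sign; case: ifP => _; [case: ifP => _|]; apply/andP; split; lra.
have eps0 n k : (N0 <= n)%N -> eps n k = 0 by rewrite /eps ltnNge => ->.
have f2 : martingale_defined eps f by exact: martingale_defined_stepf eps0.
have l0 := level_gt0.
(* No factor is lost to [pi] here; the bound is weakened so that [growth_le] serves both
   transforms. *)
apply: (@le_trans _ _ (level / 4)%:E); first by rewrite lee_fin; lra.
apply: (@weak_type_constant_ge _ _ _ true level mU l0 K0 _ (hK _ _ eps1 f1 f2)).
move=> x /(@good_level _ _ L_gt2 _ (fun N s x =>
  s < \sum_(0 <= n < 2 * L * N) layer (tree_sign L) (f_data L N) n x)).
case=> [s {}x s0 _|N i s {}x iK hx|].
- by rewrite muln0 big_geq.
- exact: (layers_step L_gt2 iK).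
rewrite inpieceE => /andP[x0 x1] h; split.
  by rewrite /unit_itv /= in_itv /= x0 ltW.
have -> : martingale eps f x =
    \sum_(0 <= n < N0) layer (tree_sign L) (f_data L (4 ^ L)) n x.
  rewrite /martingale (cvg_lim _ (@martingale_stepf R eps _ x N0 eps0)) //.
  apply: eq_big_nat => n /andP[_ nN]; apply: eq_bigr => k _.
  by rewrite /eps nN.
by rewrite ger0_norm // ltW // (lt_trans l0).
Qed.

End weight_estimates.



(** * Comparison of L with the logarithm of the [A_1] norm *)

Section asymptotics.
Context {R : realType}.
Implicit Types (a B C Qa : R) (L : nat).

(** The bound on [4 ^ L] makes the [A_1] norm large; the bound on [L] itself refutes the linear
    estimate. *)
Lemma exists_large_exponent B : exists2 L, (18 <= L)%N & B < (4 ^ L)%:R / 2 /\ B < L%:R.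
Proof.
pose L := (18 + Num.truncn (`|B| * 2))%N.
exists L; first exact: leq_addr.
have /andP[_ h] := truncn_itv (mulr_ge0 (normr_ge0 B) (ler0n R 2)).
have h1 : `|B| * 2 < L%:R.
  by apply: lt_le_trans h _; rewrite ler_nat /L addSn ltnS leq_addl.
have h2 : L%:R < (4 ^ L)%:R :> R by rewrite ltr_nat ltn_expl.
have := ler_norm B; have := normr_ge0 B; split; lra.
Qed.

(** From 161 <= 4^4 and ln 4 <= 2 follows ln Qa <= 2 (L + 4) <= 3 (L - 2). The last quantity is at
    least 1, so its power with exponent [a <= 1] does not exceed it. *)
Lemma powR_ln_le L Qa a : (18 <= L)%N -> 0 <= a <= 1 ->
  (4 ^ L)%:R / 2 <= Qa -> Qa <= 161 * (4 ^ L)%:R ->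
  (ln Qa) `^ a <= 3 * (L - 2)%:R.
Proof.
move=> L18 /andP[a0 a1] lo hi.
have L18R : 18 <= L%:R :> R by rewrite ler_nat.
have HL : L%:R <= (4 ^ L)%:R :> R by rewrite ler_nat ltnW // ltn_expl.
have Q1 : 1 <= Qa by lra.
have ln4 : ln 4 <= 2 :> R.
  rewrite -[leRHS]expRK ler_ln ?posrE ?expR_gt0 //.
  have e1 := expR_ge1Dx (1 : R); rewrite [2%:R in leRHS](_ : 2 = 1 + 1) // expRD.
  by apply: le_trans (ler_pM _ _ e1 e1); lra.
have lnQ : ln Qa <= 3 * (L - 2)%:R.
  apply: (@le_trans _ _ (ln (4 ^+ (L + 4)))).
    rewrite ler_ln ?posrE ?exprn_gt0 //; last lra.
    rewrite exprD -natrX; apply: (le_trans hi).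
    by rewrite mulrC ler_wpM2l // -natrX ler_nat.
  rewrite lnXn // -(mulr_natr (ln 4)) natrD natrB; last by apply: leq_trans L18.
  have : ln 4 * (L%:R + 4) <= 2 * (L%:R + 4) :> R by rewrite ler_wpM2r //; lra.
  lra.
have ln0 : 0 <= ln Qa by exact: ln_ge0.
have L2 : 1 <= 3 * (L - 2)%:R :> R by rewrite natrB ?(leq_trans _ L18) //; lra.
apply: (@le_trans _ _ ((3 * (L - 2)%:R) `^ a)).
  by apply: ge0_ler_powR; rewrite ?nnegrE //; lra.
rewrite -[leRHS]powRr1; last lra.
exact: ler_powR.
Qed.

(** The constant 768 is 3 * 16 * 16: the 3 of [powR_ln_le], the 16 in [level] and the 16 dividing
    it. The factor 161 is the upper bound for Qa / 4^L. *)
Lemma growth_le (c : R) L Qa a : 0 <= c -> c * (161 * 768) <= 1 ->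
  (18 <= L)%N -> 0 <= a <= 1 ->
  (4 ^ L)%:R / 2 <= Qa -> Qa <= 161 * (4 ^ L)%:R ->
  c * Qa * (ln Qa) `^ a <= level L / 16.
Proof.
move=> c0 c1 L18 a01 lo hi; have h := powR_ln_le L18 a01 lo hi.
rewrite /level; move: lo hi h.
have : 0 <= (4 ^ L)%:R :> R by []; have : 0 <= (L - 2)%:R :> R by [].
have := powR_ge0 (ln Qa) a.
move: ((4 ^ L)%:R : R) ((L - 2)%:R : R) (ln Qa `^ a) => H l P P0 l0 H0 lo hi h.
have Q0 : 0 <= Qa by lra.
have QP : Qa * P <= 161 * H * (3 * l) by exact: ler_pM.
have Hl : 0 <= H * l by exact: mulr_ge0.
have := ler_wpM2l c0 QP; have := ler_wpM2r Hl c1.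
by move=> h1 h2; lra.
Qed.

End asymptotics.

Theorem mainTheorem1 (R : realType) :
  ~ (exists C : R, forall w : R -> R,
       line_weight w -> (A1_norm w < +oo)%E ->
       (hilbert_weak_norm w <= C%:E * A1_norm w)%E)
  /\
  forall eps : R, 0 < eps < 5^-1 ->
    exists c : R, 0 < c /\
      (forall B : R, exists (w : R -> R) (Q : R),
         [/\ unit_weight w, dyadic_A1_norm w = Q%:E, B < Q &
             ((c * Q * (ln Q) `^ (5^-1 - eps))%:E <= martingale_weak_norm w)%E])
      /\
      (forall B : R, exists (w : R -> R) (Q : R),
         [/\ line_weight w, A1_norm w = Q%:E, B < Q &
             ((c * Q * (ln Q) `^ (5^-1 - eps))%:E <= hilbert_weak_norm w)%E]).
Proof.
have gt2 L : (18 <= L)%N -> (2 < L)%N by exact: leq_trans.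
split.
  move=> [C hC].
  (* The linear estimate would give Q (L - 2) / 256 <= 161 |C| Q, which this choice of [L]
     contradicts. *)
  have [L L18 [_ CL]] := exists_large_exponent (256 * 161 * `|C| + 2).
  have hL := hC _ (line_weight_weight (gt2 _ L18)).
  have up := A1_norm_weight_le (R := R) (gt2 _ L18).
  have := hL (le_lt_trans up (ltry _)).
  have H0 : 0 < (4 ^ L)%:R :> R by rewrite ltr0n expn_gt0.
  move/(le_trans (hilbert_weak_norm_ge (gt2 _ L18) L18)).
  have A0 : (0 <= A1_norm (weight (R := R) L))%E.
    apply: le_trans (A1_norm_weight_ge (gt2 _ L18)).
    by rewrite lee_fin divr_ge0.
  (* [C] may be negative, so it is replaced by its absolute value before the upper bound on the norm
     is inserted. *)
  have : (C%:E * A1_norm (weight (R := R) L) <= `|C|%:E * (161 * (4 ^ L)%:R)%:E)%E.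
    apply: (@le_trans _ _ (`|C|%:E * A1_norm (weight L))%E).
      by apply: lee_wpmul2r => //; rewrite lee_fin ler_norm.
    by apply: lee_wpmul2l => //; rewrite lee_fin.
  move=> h1 h2; have := le_trans h2 h1; rewrite -EFinM lee_fin /level.
  rewrite [leRHS](_ : _ = (4 ^ L)%:R * (161 * `|C|)); last by ring.
  rewrite -!mulrA ler_pM2l // natrB; last exact: ltnW (gt2 _ L18).
  by move: CL; lra.
move=> eps /andP[e0 e5].
have a01 : 0 <= 5^-1 - eps <= 1 by apply/andP; split; lra.
pose c : R := (161 * 768)^-1.
have c0 : 0 < c by rewrite /c invr_gt0; lra.
have c1 : c * (161 * 768) <= 1 by rewrite /c; lra.
exists c; split => //; move: c c0 c1 => c c0 c1.
split=> B; have [L L18 [BL _]] := exists_large_exponent B.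
  have [Q [QE Q1 Q2]] := dyadic_A1_norm_weight (R := R) (gt2 _ L18).
  have H0 : 0 <= (4 ^ L)%:R :> R by [].
  exists (weight L), Q; split => //; first exact: unit_weight_weight (gt2 _ L18).
    by lra.
  apply: le_trans (martingale_weak_norm_ge (gt2 _ L18) L18).
  by rewrite lee_fin; apply: growth_le => //; [exact: ltW | lra].
have up := A1_norm_weight_le (R := R) (gt2 _ L18).
have low := A1_norm_weight_ge (R := R) (gt2 _ L18).
have fn : A1_norm (weight (R := R) L) \is a fin_num.
  by rewrite fin_real // (lt_le_trans _ low) ?ltNyr //= (le_lt_trans up) ?ltry.
exists (weight L), (fine (A1_norm (weight L))).
move: up low; rewrite -{1 2}(fineK fn) !lee_fin => up low.
split; [exact: line_weight_weight (gt2 _ L18) | by rewrite fineK | lra |].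
apply: le_trans (hilbert_weak_norm_ge (gt2 _ L18) L18).
by rewrite lee_fin; apply: growth_le => //; exact: ltW.
Qed.
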